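(* There exists an absolute constant $C_0 \geq 1$ such that the following holds. Let $z$ be a complex random variable with mean $0$ and variance $1$, let $n$ be a positive integer and $\eta$ a real number with $2^{-n^{0.0001}}\leq \eta < n^{-2}$, let $M$ be a fixed $n\times n$ complex matrix with operator norm at most $n^{0.51}$, let $N_n$ be an $n\times n$ random matrix whose entries are independent copies of $z$, and let $M_n:=M+N_n$. Then \begin{align*} \Pr\left(\exists \boldsymbol{a} \in \Gamma^{2}(\eta):\|M_{n}\boldsymbol{a}\|_{2}\leq \eta \right) \leq\ & C_0 e^{-n^{0.99}/10} \\ & + \Pr\left(\exists \boldsymbol{w} \in \boldsymbol{V}\text{ and } K\in \mathcal{K} : \|P_{K}M_{n}\boldsymbol{w}\|_{2}\leq C_0\min\{n^{0.21}\|\boldsymbol{w}\|_{2}, n^{0.711}\}\right). \end{align*}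
   Context: $\mathbb{S}^{2n-1}$ denotes the set of unit vectors in $\mathbb{C}^n$, and $[n]=\{1,\dots,n\}$. Put $\alpha:=n^{1/100}$ and $\gamma:=n^{-1/2}$. For $\boldsymbol{a}\in\mathbb{C}^n\setminus\{\boldsymbol 0\}$, $$\mathrm{LCD}_{\gamma,\alpha}(\boldsymbol{a}):=\inf_{\theta\in\mathbb{C}}\left\{|\theta|>0 : \mathrm{dist}(\theta\boldsymbol{a},(\mathbb{Z}+i\mathbb{Z})^n)<\min\{\gamma|\theta|\,\|\boldsymbol{a}\|_2,\alpha\}\right\},$$ where $\mathrm{dist}$ is Euclidean distance. $\Gamma^1(\eta):=\{\boldsymbol{a}\in\mathbb{S}^{2n-1}:\mathrm{LCD}_{\gamma,\alpha}(\boldsymbol{a})\geq n^{0.7}\eta^{-1}\}$ and $\Gamma^2(\eta):=\mathbb{S}^{2n-1}\setminus\Gamma^1(\eta)$. $\mathcal{K}:=\{K\subseteq[n]:|K|\geq n-6n^{0.99}\}$. $\boldsymbol{V}:=\{\boldsymbol{v}\in(\mathbb{Z}+i\mathbb{Z})^n\setminus\{\boldsymbol 0\} : \|\Re(\boldsymbol{v})\|_\infty,\|\Im(\boldsymbol{v})\|_\infty\leq 2\eta^{-1}n^{3/4}\}$, where $\Re,\Im$ denote coordinatewise real and imaginary parts. For $K\subseteq[n]$, $P_K:\mathbb{C}^n\to\mathbb{C}^n$ is the orthogonal projection onto the span of the standard basis vectors $\{e_i:i\in K\}$. The operator norm is the $\ell^2\to\ell^2$ norm. *)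

(* Defs.v *)
(* MathComp-Analysis, over an arbitrary R : realType, with the complex numbers
   R[i] of mathcomp-real-closed. *)
From HB Require Import structures.
From mathcomp Require Export all_boot all_order all_algebra.
From mathcomp Require Export complex.
From mathcomp Require Export all_classical all_reals all_analysis.
Export Order.TTheory GRing.Theory Num.Theory.
Export numFieldNormedType.Exports.

#[export] Set Implicit Arguments.
#[export] Unset Strict Implicit.
#[export] Unset Printing Implicit Defensive.

Local Open Scope classical_set_scope.
Local Open Scope ring_scope.

(* The norm of R[i] in the library takes values in R[i]; [cabs] is the same
   modulus with values in R. *)
Definition cabs (R : realType) (x : R[i]) : R := complex.Re `|x|.

Definition gaussZ (R : realType) : set R[i] :=
  [set x | exists a b : int, x = Complex (a%:~R : R) (b%:~R : R)].

Definition l2norm (R : realType) (n : nat) (v : 'cV[R[i]]_n) : R :=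
  Num.sqrt (\sum_i cabs (v i 0) ^+ 2).

Definition opnorm (R : realType) (n : nat) (A : 'M[R[i]]_n) : \bar R :=
  ereal_sup [set (l2norm (A *m x))%:E | x in [set x | l2norm x <= 1]].

Definition Cvec_Re (R : realType) (n : nat) (v : 'cV[R[i]]_n) : 'cV[R]_n :=
  map_mx (@complex.Re R) v.

Definition Cvec_Im (R : realType) (n : nat) (v : 'cV[R[i]]_n) : 'cV[R]_n :=
  map_mx (@complex.Im R) v.

Definition gaussZn (R : realType) (n : nat) : set 'cV[R[i]]_n :=
  [set v | forall i, gaussZ (v i 0)].

Definition dist (R : realType) (n : nat) (x : 'cV[R[i]]_n)
    (A : set 'cV[R[i]]_n) : R :=
  inf [set l2norm (x - y) | y in A].

Definition unit_sphere (R : realType) (n : nat) : set 'cV[R[i]]_n :=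
  [set a | l2norm a = 1].

Definition alpha (R : realType) (n : nat) : R := n%:R `^ (1 / 100).
Definition gamma (R : realType) (n : nat) : R := n%:R `^ (- (1 / 2)).

(* The infimum is taken in \bar R, so that it is +oo on the empty set. *)
Definition LCD (R : realType) (n : nat) (g al : R) (a : 'cV[R[i]]_n) : \bar R :=
  ereal_inf [set (cabs theta)%:E | theta in
    [set theta : R[i] | 0 < cabs theta /\
      dist (theta *: a) (@gaussZn R n) <
        Num.min (g * cabs theta * l2norm a) al]].

Definition Gamma1 (R : realType) (n : nat) (eta : R) : set 'cV[R[i]]_n :=
  [set a | unit_sphere a /\
    ((n%:R `^ (7 / 10) * eta^-1)%:E <= LCD (gamma R n) (alpha R n) a)%E].

Definition Gamma2 (R : realType) (n : nat) (eta : R) : set 'cV[R[i]]_n :=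
  @unit_sphere R n `\` @Gamma1 R n eta.

Definition calK (R : realType) (n : nat) : set {set 'I_n} :=
  [set K : {set 'I_n} |
     n%:R - 6 * n%:R `^ (99 / 100) <= (#|K|%:R : R)].

(* `|_| on 'cV[R]_n is the sup norm. *)
Definition bfV (R : realType) (n : nat) (eta : R) : set 'cV[R[i]]_n :=
  [set v | [/\ gaussZn v, v != 0,
     `|Cvec_Re v| <= 2 * eta^-1 * n%:R `^ (3 / 4) &
     `|Cvec_Im v| <= 2 * eta^-1 * n%:R `^ (3 / 4)]].

(* sum over K of the rank-one projections e_i e_i^* *)
Definition coord_proj (R : realType) (n : nat) (K : {set 'I_n}) : 'M[R[i]]_n :=
  \sum_(i in K) delta_mx i i.

(* R[i] carries no sigma-algebra in the library: measurability and laws of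
   complex random variables are expressed through C ~ R * R. *)
Definition C2RR (R : realType) (x : R[i]) : R * R :=
  (complex.Re x, complex.Im x).

Definition complex_RV d (T : measurableType d) (R : realType)
    (X : T -> R[i]) : Prop :=
  measurable_fun setT (@C2RR R \o X).

Definition complex_integrable d (T : measurableType d) (R : realType)
    (P : probability T R) (X : T -> R[i]) : Prop :=
  P.-integrable setT (EFin \o (@complex.Re R \o X)) /\
  P.-integrable setT (EFin \o (@complex.Im R \o X)).

Definition complex_mean d (T : measurableType d) (R : realType)
    (P : probability T R) (X : T -> R[i]) : R[i] :=
  Complex (fine 'E_P[@complex.Re R \o X]) (fine 'E_P[@complex.Im R \o X]).

Definition complex_variance d (T : measurableType d) (R : realType)
    (P : probability T R) (X : T -> R[i]) : \bar R :=
  'E_P[fun t => cabs (X t - complex_mean P X) ^+ 2].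

(* X has the same law as Z; X and Z may live on different spaces. *)
Definition same_law d (T : measurableType d) d0 (T0 : measurableType d0)
    (R : realType) (P : probability T R) (P0 : probability T0 R)
    (X : T -> R[i]) (Z : T0 -> R[i]) : Prop :=
  forall B : set (R * R), measurable B ->
    P ((@C2RR R \o X) @^-1` B) = P0 ((@C2RR R \o Z) @^-1` B).

Definition mutually_independent d (T : measurableType d) (R : realType)
    (P : probability T R) (I : finType) (X : I -> T -> R[i]) : Prop :=
  forall (J : {set I}) (B : I -> set (R * R)),
    (forall i, measurable (B i)) ->
    P (\bigcap_(i in [set` J]) ((@C2RR R \o X i) @^-1` B i)) =
    (\prod_(i in J) P ((@C2RR R \o X i) @^-1` B i))%E.

Definition iid_matrix d (T : measurableType d) d0 (T0 : measurableType d0)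
    (R : realType) (P : probability T R) (P0 : probability T0 R)
    (n : nat) (N : T -> 'M[R[i]]_n) (z : T0 -> R[i]) : Prop :=
  [/\ forall i j, complex_RV (fun t => N t i j),
      forall i j, same_law P P0 (fun t => N t i j) z &
      mutually_independent P (fun (ij : 'I_n * 'I_n) t => N t ij.1 ij.2)].

(* Main.v *)
From HB Require Import structures.
Require Import Defs.
From mathcomp Require Import measurable_realfun ring lra.

(** If [a] lies in [Gamma2 eta], there are a complex number [theta] with
    [0 < |theta| < n^0.7 / eta] and a Gaussian integer vector [w] such that the
    error [b = w - theta a] has norm below [min (n^-0.5 |theta|, n^0.01)].  Then
    [w] is nonzero, [|theta| <= 2 |w|], and, writing [M_n = M + N],
    [M_n w = theta (M_n a) + M b + N b].  The first two terms are small because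
    [|M_n a| <= eta] and [|M| <= n^0.51].  So it suffices that, outside an event
    of probability at most [C exp (- n^0.99 / 10)], every vector [b] admits a set
    [K] of at least [n - 2 n^0.99] rows for which [|P_K N b| <= 4 n^0.7 |b|];
    this is [good_rows_exist].  The set [K] may depend on [b].

    For a fixed unit vector [b], Chebyshev's inequality shows that a row [X] of
    [N] satisfies [|<X, b>| > n^0.2] with probability at most [n^-0.4], and the
    rows are independent; so more than [n^0.99] rows do so only with probability
    about [exp (- n^0.99)] ([count_tail]).  A net of the sphere is far too large
    for a union bound.  Instead, [b] is rounded to a random point of the lattice
    of mesh [s = n^-0.35].  The rounding errors of the coordinates are centred
    and independent, so that the mean of [|A (b - b')|^2] is at most [s^2] times
    the sum of the squared entries of [A], and the mean l1-norm is preserved: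
    [b'] is a sum of [O (n^0.85)] steps of length [s] along the coordinate axes.
    There are only [exp (O (n^0.9))] such vectors, which the union bound affords.
    The argument is applied to the rows of squared norm at most [n^1.1]; all but
    [n^0.99] rows are of this kind, by Markov's inequality and [count_tail].  The
    rounding is derandomised coordinate by coordinate in [round_vector].

    Two further points need care.  The independence of the entries has to be
    transferred to events that depend on whole rows
    ([independent_sigma_algebras]) and to products of two entries
    ([integral_mul_independent]).  And the event on the left-hand side is an
    uncountable union: it is measurable because the pairs [(a, theta)] that
    witness it range over a countable union of compact sets
    ([measurable_exists_nonpos]).  The absolute constant is chosen so large that
    the bound is at least 1 unless [n^0.09 >= 300]. *)

Local Open Scope classical_set_scope.
Local Open Scope ring_scope.

(** * Complex moduli and Euclidean norms *)

Section Norms.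
Variable R : realType.
Implicit Types (x y : R[i]) (c : R).

Definition sqn n (v : 'cV[R[i]]_n) : R :=
  \sum_i (complex.Re (v i 0) ^+ 2 + complex.Im (v i 0) ^+ 2).

Lemma cabsE x : cabs x = Num.sqrt (complex.Re x ^+ 2 + complex.Im x ^+ 2).
Proof. by rewrite /cabs normc_def. Qed.

Lemma sqr_cabs x : cabs x ^+ 2 = complex.Re x ^+ 2 + complex.Im x ^+ 2.
Proof. by rewrite cabsE sqr_sqrtr // addr_ge0 // sqr_ge0. Qed.

Lemma cabs_ge0 x : 0 <= cabs x. Proof. by rewrite cabsE sqrtr_ge0. Qed.

Lemma cabsM x y : cabs (x * y) = cabs x * cabs y.
Proof.
rewrite !cabsE -sqrtrM ?addr_ge0 ?sqr_ge0 //; congr Num.sqrt.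
by case: x => a b; case: y => e f /=; ring.
Qed.

Lemma ReD x y : complex.Re (x + y) = complex.Re x + complex.Re y.
Proof. by case: x; case: y. Qed.
Lemma ImD x y : complex.Im (x + y) = complex.Im x + complex.Im y.
Proof. by case: x; case: y. Qed.
Lemma ReM x y : complex.Re (x * y) =
  complex.Re x * complex.Re y - complex.Im x * complex.Im y.
Proof. by case: x; case: y. Qed.
Lemma ImM x y : complex.Im (x * y) =
  complex.Re x * complex.Im y + complex.Im x * complex.Re y.
Proof. by case: x => a b; case: y => e f. Qed.

Lemma Re_sum (I : Type) (r : seq I) (Q : pred I) (F : I -> R[i]) :
  complex.Re (\sum_(i <- r | Q i) F i) = \sum_(i <- r | Q i) complex.Re (F i).
Proof. by apply: (big_morph _ ReD). Qed.

Lemma Im_sum (I : Type) (r : seq I) (Q : pred I) (F : I -> R[i]) :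
  complex.Im (\sum_(i <- r | Q i) F i) = \sum_(i <- r | Q i) complex.Im (F i).
Proof. by apply: (big_morph _ ImD). Qed.

Lemma normr_Re_le x : `|complex.Re x| <= cabs x.
Proof. by rewrite cabsE -sqrtr_sqr ler_wsqrtr // lerDl sqr_ge0. Qed.

Lemma normr_Im_le x : `|complex.Im x| <= cabs x.
Proof. by rewrite cabsE -sqrtr_sqr ler_wsqrtr // lerDr sqr_ge0. Qed.

Lemma cabs_real c : cabs (c%:C)%C = `|c|.
Proof. by rewrite cabsE /= expr0n /= addr0 sqrtr_sqr. Qed.

Lemma sqn_ge0 n (v : 'cV[R[i]]_n) : 0 <= sqn v.
Proof. by apply: sumr_ge0 => i _; rewrite addr_ge0 ?sqr_ge0. Qed.

Lemma sqnE n (v : 'cV[R[i]]_n) : sqn v = \sum_i cabs (v i 0) ^+ 2.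
Proof. by apply: eq_bigr => i _; rewrite sqr_cabs. Qed.

Lemma l2normE n (v : 'cV[R[i]]_n) : l2norm v = Num.sqrt (sqn v).
Proof. by rewrite sqnE. Qed.

Lemma l2norm_ge0 n (v : 'cV[R[i]]_n) : 0 <= l2norm v.
Proof. by rewrite l2normE sqrtr_ge0. Qed.

Lemma sqr_l2norm n (v : 'cV[R[i]]_n) : l2norm v ^+ 2 = sqn v.
Proof. by rewrite l2normE sqr_sqrtr // sqn_ge0. Qed.

Lemma l2normZ n (x : R[i]) (v : 'cV[R[i]]_n) : l2norm (x *: v) = cabs x * l2norm v.
Proof.
rewrite /l2norm -[cabs x]ger0_norm ?cabs_ge0 // -sqrtr_sqr -sqrtrM ?sqr_ge0 //.
by rewrite mulr_sumr; congr Num.sqrt; apply: eq_bigr => i _; rewrite mxE cabsM exprMn.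
Qed.

Lemma l2normN n (v : 'cV[R[i]]_n) : l2norm (- v) = l2norm v.
Proof.
rewrite !l2normE; congr Num.sqrt; apply: eq_bigr => i _.
by rewrite mxE; case: (v i 0) => a b /=; rewrite !sqrrN.
Qed.

Lemma l2norm_coord n (v : 'cV[R[i]]_n) i : cabs (v i 0) <= l2norm v.
Proof.
rewrite -[cabs _]ger0_norm ?cabs_ge0 // -sqrtr_sqr; apply: ler_wsqrtr.
by rewrite (bigD1 i) //= lerDl sumr_ge0 // => j _; rewrite sqr_ge0.
Qed.

Lemma l2norm_eq0 n (v : 'cV[R[i]]_n) : l2norm v = 0 -> v = 0.
Proof.
move=> v0; apply/matrixP => i j; rewrite ord1 mxE; apply/eqP.
have := l2norm_coord v i; rewrite v0 => h.
have /eqP c0 : cabs (v i 0) == 0 by rewrite eq_le h cabs_ge0.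
have : cabs (v i 0) ^+ 2 = 0 by rewrite c0 expr0n.
rewrite sqr_cabs => /eqP; rewrite paddr_eq0 ?sqr_ge0 // !sqrf_eq0.
by rewrite eq_complex.
Qed.

Lemma l2norm0 n : l2norm (0 : 'cV[R[i]]_n) = 0.
Proof.
rewrite l2normE /sqn big1 ?sqrtr0 // => i _.
by rewrite mxE /= expr0n /= addr0.
Qed.

Lemma sqn_add_le n (u v : 'cV[R[i]]_n) c : 0 < c ->
  sqn (u + v) <= (1 + c) * sqn u + (1 + c^-1) * sqn v.
Proof.
move=> c0; have ci : 0 < c^-1 by rewrite invr_gt0.
have sq (a b : R) : (a + b) ^+ 2 <= (1 + c) * a ^+ 2 + (1 + c^-1) * b ^+ 2.
  have -> : (1 + c) * a ^+ 2 + (1 + c^-1) * b ^+ 2 =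
    (a + b) ^+ 2 + c^-1 * (c * a - b) ^+ 2 by field; rewrite gt_eqF.
  by rewrite lerDl mulr_ge0 ?sqr_ge0 // ltW.
rewrite /sqn !mulr_sumr -big_split /=; apply: ler_sum => i _.
rewrite mxE ReD ImD; have := sq (complex.Re (u i 0)) (complex.Re (v i 0)).
have := sq (complex.Im (u i 0)) (complex.Im (v i 0)); lra.
Qed.

(** Weighting the two terms by the ratio of the norms makes the elementary
    bound above sharp, which gives the triangle inequality without a
    Cauchy-Schwarz inequality. *)
Lemma l2norm_triangle n (u v : 'cV[R[i]]_n) : l2norm (u + v) <= l2norm u + l2norm v.
Proof.
have [u0|u0] := eqVneq (l2norm u) 0.
  by rewrite (l2norm_eq0 u0) l2norm0 !add0r.
have [v0|v0] := eqVneq (l2norm v) 0.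
  by rewrite (l2norm_eq0 v0) l2norm0 !addr0.
have up : 0 < l2norm u by rewrite lt_def u0 l2norm_ge0.
have vp : 0 < l2norm v by rewrite lt_def v0 l2norm_ge0.
rewrite -(@ler_pXn2r _ 2) ?nnegrE ?addr_ge0 ?l2norm_ge0 // sqr_l2norm.
have := @sqn_add_le _ u v (l2norm v / l2norm u) (divr_gt0 vp up).
rewrite -!sqr_l2norm => /le_trans; apply.
rewrite le_eqVlt; apply/orP; left; apply/eqP; field.
by rewrite u0 v0.
Qed.

Lemma coord_projE n m (K : {set 'I_n}) (B : 'M[R[i]]_(n, m)) i j :
  (coord_proj R K *m B) i j = if i \in K then B i j else 0.
Proof.
rewrite mxE.
have -> : \sum_k coord_proj R K i k * B k j = \sum_k (if (i == k) && (i \in K) then B k j else 0).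
  apply: eq_bigr => k _; rewrite /coord_proj summxE.
  case: ifP => [/andP[/eqP <- iK]|ik].
    rewrite (bigD1 i) //= mxE !eqxx big1 ?addr0 ?mul1r // => l /andP[_ li].
    by rewrite mxE eq_sym (negbTE li).
  rewrite big1 ?mul0r // => l lK; rewrite mxE.
  case: eqP => //= il; case: eqP => //= kl.
  by move: ik; rewrite il kl eqxx lK.
case: ifP => iK; last by rewrite big1 // => k _; rewrite andbF.
rewrite (bigD1 i) //= eqxx /= big1 ?addr0 // => k /negbTE; rewrite eq_sym => -> //.
Qed.

Lemma sqn_coord_proj n (K : {set 'I_n}) (v : 'cV[R[i]]_n) :
  sqn (coord_proj R K *m v) = \sum_(i in K) cabs (v i 0) ^+ 2.
Proof.
rewrite sqnE [RHS]big_mkcond; apply: eq_bigr => i _; rewrite coord_projE.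
by case: ifP => // _; rewrite cabsE /= expr0n /= addr0 sqrtr0 expr0n.
Qed.

Lemma l2norm_coord_proj_le n (K : {set 'I_n}) (v : 'cV[R[i]]_n) :
  l2norm (coord_proj R K *m v) <= l2norm v.
Proof.
rewrite !l2normE; apply: ler_wsqrtr.
rewrite sqn_coord_proj sqnE [leRHS](bigID (mem K)) /= lerDl.
by apply: sumr_ge0 => i _; rewrite sqr_ge0.
Qed.

Lemma l2norm_mulmx_le n (A : 'M[R[i]]_n) c (v : 'cV[R[i]]_n) :
  (opnorm A <= c%:E)%E -> l2norm (A *m v) <= c * l2norm v.
Proof.
move=> Ac; have [v0|v0] := eqVneq (l2norm v) 0.
  by rewrite (l2norm_eq0 v0) mulmx0 !l2norm0 mulr0.
have vp : 0 < l2norm v by rewrite lt_def v0 l2norm_ge0.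
pose u := ((l2norm v)^-1%:C)%C *: v.
have un : l2norm u = 1.
  by rewrite l2normZ cabs_real ger0_norm ?invr_ge0 ?l2norm_ge0 // mulVf.
have : ((l2norm (A *m u))%:E <= c%:E)%E.
  apply: le_trans Ac; apply: ereal_sup_ubound; exists u => //=.
  by rewrite un.
rewrite lee_fin -scalemxAr l2normZ cabs_real ger0_norm ?invr_ge0 ?l2norm_ge0 //.
by rewrite ler_pdivrMl // mulrC.
Qed.

End Norms.

(** * Rounding to sparse lattice vectors *)

Section Rounding.
Variables (R : realType) (n : nat).
Implicit Types (v g b : 'cV[R[i]]_n) (q : 'cV[R[i]]_n -> R).

(** The [2 n] real coordinate axes of [C^n]; the boolean selects the imaginary
    direction. *)
Definition axis : Type := ('I_n * bool)%type.
Definition axis_vec (x : axis) : 'cV[R[i]]_n :=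
  (if x.2 then 'i%C else 1) *: delta_mx x.1 0.
Definition axis_coord b (x : axis) : R :=
  if x.2 then complex.Im (b x.1 0) else complex.Re (b x.1 0).

(** A letter is a unit step along a signed axis.  The neutral letter [None]
    allows words to be padded to a common length, so that all the lattice points
    of bounded l1-norm are covered by one finite type of tuples. *)
Definition letter : Type := option (axis * bool).
Definition letter_vec (l : letter) : 'cV[R[i]]_n :=
  if l is Some (x, s) then (-1) ^+ s *: axis_vec x else 0.
Definition word_vec (W : seq letter) : 'cV[R[i]]_n := \sum_(l <- W) letter_vec l.

Lemma axis_decomposition b : b = \sum_(x : axis) (axis_coord b x)%:C%C *: axis_vec x.
Proof.
apply/matrixP => k j; rewrite ord1 {j} summxE.
rewrite -(pair_bigA _ (fun i r => ((axis_coord b (i, r))%:C%C *: axis_vec (i, r)) k 0)) /=.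
rewrite (bigD1 k) //= [X in _ + X]big1 ?addr0; last first.
  move=> i ik; rewrite big_bool /= !mxE.
  by rewrite eq_sym (negbTE ik) /= !mulr0 addr0.
rewrite big_bool /axis_coord /axis_vec /= !mxE !eqxx /=; case: (b k 0) => x y /=.
by apply/eqP; rewrite eq_complex /= !(mulr0,mul0r,mulr1,add0r,addr0,subr0,oppr0) !eqxx.
Qed.

(** Only the expansion along real lines matters for the rounding, not the
    bilinear form itself. *)
Definition quadratic q := forall v g, exists beta : R, forall c : R,
  q (v + c%:C%C *: g) = q v + c * beta + c ^+ 2 * q g.

(** Derandomised rounding of one coordinate: choosing [floor (u / s)] or its
    successor with the weights that average to [u / s] cancels the linear term
    of [q] and preserves the average of the absolute value, so one of the two
    choices is at least as good as the average. *)
Lemma round_axis q (s kappa : R) v x (u : R) : quadratic q ->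
  0 < s -> 0 <= kappa -> 0 <= q (axis_vec x) ->
  exists W : seq letter,
    q (v + u%:C%C *: axis_vec x - s%:C%C *: word_vec W) + kappa * s * (size W)%:R
    <= q v + s ^+ 2 * q (axis_vec x) + kappa * `|u|.
Proof.
move=> qq s0 kap0 qx0; pose k0 := Num.floor (u / s).
pose p := u / s - k0%:~R.
have us : u = s * (k0%:~R + p) by rewrite /p; field; rewrite gt_eqF.
have p0 : 0 <= p by rewrite /p subr_ge0 floor_le_tmp.
have p1 : p <= 1.
  by rewrite /p lerBlDl; have := floorD1_gt (u / s); rewrite intrD => /ltW.
clearbody p k0.
have [beta qE] := qq v (axis_vec x).
pose f (k : int) : R := q v + (u - s * k%:~R) * beta
  + (u - s * k%:~R) ^+ 2 * q (axis_vec x) + kappa * s * `|k%:~R|.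
(* The integer multiple [k] of an axis is spelled by [|k|] equal letters. *)
have fW (k : int) : exists W : seq letter,
    q (v + u%:C%C *: axis_vec x - s%:C%C *: word_vec W) + kappa * s * (size W)%:R = f k.
  exists (nseq `|k|%N (Some (x, (k < 0)))).
  rewrite /f size_nseq -[`|k%:~R|]intr_norm -abszE; congr (_ + _).
  rewrite -qE; congr q.
  have -> : word_vec (nseq `|k|%N (Some (x, k < 0))) = (k%:~R : R)%:C%C *: axis_vec x.
    rewrite /word_vec big_nseq iter_addr addr0 /letter_vec -scaler_nat scalerA.
    congr (_ *: _); rewrite rmorph_int [in RHS](intEsign k) rmorphM /= rmorph_sign mulrC.
    by [].
  by rewrite scalerA -addrA -scalerBl -rmorphM -rmorphB.
have avg : (1 - p) * f k0 + p * f (k0 + 1) <=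
    q v + s ^+ 2 * q (axis_vec x) + kappa * `|u|.
  (* The two candidates lie on the same side of 0, so the absolute value is
     affine between them. *)
  have absE : (1 - p) * `|k0%:~R : R| + p * `|(k0 + 1)%:~R : R| = `|k0%:~R + p|.
    have [k00|k00] := leP 0 k0.
      have k0R : 0 <= (k0%:~R : R) by rewrite ler0z.
      by rewrite intrD !ger0_norm ?addr_ge0 //; ring.
    have k01 : k0 + 1 <= 0 by rewrite lezD1.
    have : (k0 + 1)%:~R <= (0:R) by rewrite lerz0.
    rewrite intrD => k1R.
    by rewrite !ler0_norm //; [ring|lra|lra].
  have -> : `|u| = s * `|k0%:~R + p| by rewrite {1}us normrM gtr0_norm.
  rewrite -absE /f intrD us.
  have pp : p * (1 - p) * q (axis_vec x) <= q (axis_vec x).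
    rewrite -[leRHS]mul1r ler_wpM2r //; nra.
  have : s ^+ 2 * (p * (1 - p) * q (axis_vec x)) <= s ^+ 2 * q (axis_vec x).
    by rewrite ler_wpM2l // sqr_ge0.
  move=> h.
  rewrite -subr_ge0; move: h; rewrite -subr_ge0 => /le_trans; apply.
  rewrite le_eqVlt; apply/orP; left; apply/eqP.
  set a0 := `| _ |; set a1 := `| _ |; ring.
have [h|h] := leP (f k0) (q v + s ^+ 2 * q (axis_vec x) + kappa * `|u|).
  by have [W WE] := fW k0; exists W; rewrite WE.
have [W WE] := fW (k0 + 1); exists W; rewrite WE leNgt; apply/negP => h'.
move: avg h h'; move: (f k0) (f _) (_ + kappa * _) => f0 f1 B.
rewrite leNgt => /negP avg h h'; apply: avg.
by have [p2|p2] := leP p (1 / 2); nra.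
Qed.

(** The coordinates are rounded one after the other, the accumulated error
    serving as the base point of the next step. *)
Lemma round_vector q (s kappa : R) b : quadratic q ->
  q 0 = 0 -> 0 < s -> 0 <= kappa -> (forall x, 0 <= q (axis_vec x)) ->
  exists W : seq letter,
    q (b - s%:C%C *: word_vec W) + kappa * s * (size W)%:R
    <= s ^+ 2 * (\sum_x q (axis_vec x)) + kappa * \sum_x `|axis_coord b x|.
Proof.
move=> qq q00 s0 kap0 qx0.
rewrite {1}(axis_decomposition b).
elim: (index_enum _) => [|x r [W IH]].
  exists [::]; rewrite !big_nil /word_vec big_nil scaler0 subr0 q00 /=.
  by rewrite !mulr0 addr0.
have [W' hW'] := round_axis (\sum_(x <- r) (axis_coord b x)%:C%C *: axis_vec x
   - s%:C%C *: word_vec W) (axis_coord b x) qq s0 kap0 (qx0 x).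
exists (W ++ W'); rewrite !big_cons size_cat natrD.
have -> : word_vec (W ++ W') = word_vec W + word_vec W' by rewrite /word_vec big_cat.
move: hW'; set Y := \sum_(x0 <- r) _ *: _; rewrite scalerDr.
rewrite [_ + Y]addrC opprD !addrA.
rewrite [Y - _ + _]addrAC.
move: (q (_ + _ - _ - _)) => q1; move: IH; rewrite -/Y; move: (q (Y - _)) => q2; lra.
Qed.

End Rounding.

Section Net.
Variables (R : realType) (n : nat).
Implicit Types (b : 'cV[R[i]]_n) (A N : 'M[R[i]]_n).

Lemma sqn_addZ m (v g : 'cV[R[i]]_m) (c : R) :
  sqn (v + c%:C%C *: g) = sqn v
    + c * (\sum_i (complex.Re (v i 0) * complex.Re (g i 0)
                   + complex.Im (v i 0) * complex.Im (g i 0)) *+ 2)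
    + c ^+ 2 * sqn g.
Proof.
rewrite /sqn !mulr_sumr -!big_split /=; apply: eq_bigr => i _.
rewrite !mxE; case: (v i 0) => a1 a2; case: (g i 0) => e f /=; ring.
Qed.

Lemma quadratic_sqn_mulmx A (h k : R) :
  quadratic (fun v => h * sqn (A *m v) + k * sqn v).
Proof.
move=> v g.
exists (h * (\sum_i (complex.Re ((A *m v) i 0) * complex.Re ((A *m g) i 0)
                   + complex.Im ((A *m v) i 0) * complex.Im ((A *m g) i 0)) *+ 2)
  + k * (\sum_i (complex.Re (v i 0) * complex.Re (g i 0)
                   + complex.Im (v i 0) * complex.Im (g i 0)) *+ 2)).
move=> c; rewrite mulmxDr -scalemxAr !sqn_addZ; ring.
Qed.

Lemma sqnZ_unit m (x : R[i]) (v : 'cV[R[i]]_m) : cabs x = 1 -> sqn (x *: v) = sqn v.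
Proof. by move=> x1; rewrite -!sqr_l2norm l2normZ x1 mul1r. Qed.

Lemma cabs_axis_unit (x : axis n) : cabs (if x.2 then 'i%C else 1 : R[i]) = 1.
Proof. by case: x.2; rewrite cabsE /= !(expr0n, expr1n) /= ?(addr0, add0r) sqrtr1. Qed.

Lemma sqn_mulmx_axis A (x : axis n) :
  sqn (A *m axis_vec R x) = \sum_i cabs (A i x.1) ^+ 2.
Proof.
rewrite /axis_vec -scalemxAr sqnZ_unit ?cabs_axis_unit // sqnE.
apply: eq_bigr => i _; congr (cabs _ ^+ 2); rewrite mxE (bigD1 x.1) //= big1.
  by rewrite mxE !eqxx mulr1 addr0.
by move=> j jx; rewrite mxE (negbTE jx) mulr0.
Qed.

Lemma sum_axis (F : 'I_n -> R) : \sum_(x : axis n) F x.1 = 2 * \sum_j F j.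
Proof.
rewrite -(pair_bigA _ (fun i (r : bool) => F i)) /= mulr_sumr.
by apply: eq_bigr => i _; rewrite big_bool /= mulr_natl mulr2n.
Qed.

(** This is Cauchy-Schwarz, in the form of an arithmetic-geometric inequality
    weighted by [sqrt n]. *)
Lemma sum_axis_coord b : l2norm b <= 1 -> (0 < n)%N ->
  \sum_x `|axis_coord b x| <= 2 * Num.sqrt n%:R.
Proof.
move=> b1 n0; set r := Num.sqrt n%:R.
have r0 : 0 < r by rewrite sqrtr_gt0 ltr0n.
have rr : r * r = n%:R by rewrite -expr2 sqr_sqrtr // ler0n.
have sq1 : \sum_x axis_coord b x ^+ 2 <= 1.
  rewrite -(pair_bigA _ (fun i (r : bool) => axis_coord b (i, r) ^+ 2)) /=.
  apply: (@le_trans _ _ (sqn b)).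
    by apply: ler_sum => i _; rewrite big_bool /axis_coord /= addrC.
  by rewrite -sqr_l2norm expr_le1 // l2norm_ge0.
apply: (@le_trans _ _ (\sum_x (r * axis_coord b x ^+ 2 + r^-1) / 2)).
  apply: ler_sum => x _; set c := axis_coord b x.
  rewrite ler_pdivlMr // -real_normK ?num_real //.
  have ri : r * r^-1 = 1 by rewrite mulfV // gt_eqF.
  have : 0 <= r * (`|c| - r^-1) ^+ 2 by rewrite mulr_ge0 ?sqr_ge0 // ltW.
  have -> : r * (`|c| - r^-1) ^+ 2 = r * `|c| ^+ 2 - 2 * (r * r^-1) * `|c| + (r * r^-1) * r^-1 by ring.
  rewrite ri; lra.
rewrite -mulr_suml big_split /= -mulr_sumr.
rewrite (_ : \sum_(x : axis n) r^-1 = 2 * r); last first.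
  rewrite (sum_axis (fun=> r^-1)) sumr_const card_ord -[r^-1 *+ n]mulr_natr -rr.
  by field; rewrite gt_eqF.
have : r * \sum_x axis_coord b x ^+ 2 <= r * 1 by rewrite ler_wpM2l // ltW.
lra.
Qed.

(** Applying the rounding lemma to a quadratic form that adds the error after
    multiplication by [A] to the size of the error itself controls both, while
    the linear penalty keeps the word short. *)
Lemma sparse_approximation A b (H s : R) : (0 < n)%N -> 0 < H -> 0 < s ->
  \sum_i \sum_j cabs (A i j) ^+ 2 <= H -> l2norm b <= 1 ->
  exists W : seq (letter n),
    [/\ (size W)%:R <= 6 * Num.sqrt n%:R / s,
        sqn (b - s%:C%C *: word_vec R W) <= 6 * s ^+ 2 * n%:R
      & sqn (A *m (b - s%:C%C *: word_vec R W)) <= 6 * s ^+ 2 * H].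
Proof.
move=> n0 H0 s0 AH b1.
have nR : 0 < n%:R :> R by rewrite ltr0n.
set r := Num.sqrt (n%:R : R).
have r0 : 0 < r by rewrite sqrtr_gt0 ltr0n.
pose q v := H^-1 * sqn (A *m v) + n%:R^-1 * sqn v.
(* The weights balance the three contributions: each of them is of order
   [s^2] in the bound of the rounding lemma. *)
have kap0 : 0 <= s ^+ 2 / r by rewrite divr_ge0 ?sqr_ge0 // ltW.
have Hi : 0 < H^-1 by rewrite invr_gt0.
have ni : 0 < n%:R^-1 :> R by rewrite invr_gt0.
have q0 v : 0 <= q v by rewrite addr_ge0 // mulr_ge0 ?sqn_ge0 // ltW.
have sqn0 m : sqn (0 : 'cV[R[i]]_m) = 0 by rewrite -sqr_l2norm l2norm0 expr0n.
have q00 : q 0 = 0 by rewrite /q mulmx0 !sqn0 !mulr0 addr0.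
have qsum : \sum_x q (axis_vec R x) <= 4.
  rewrite big_split /= -!mulr_sumr.
  under eq_bigr do rewrite sqn_mulmx_axis.
  rewrite (sum_axis (fun j => \sum_i cabs (A i j) ^+ 2)) exchange_big /=.
  have -> : \sum_(x : axis n) sqn (axis_vec R x) = 2 * n%:R.
    under eq_bigr do rewrite -[axis_vec R _]mul1mx sqn_mulmx_axis.
    rewrite (sum_axis (fun j => \sum_i cabs ((1%:M : 'M[R[i]]_n) i j) ^+ 2)).
    congr (_ * _); transitivity (\sum_(j < n) (1 : R)); last by rewrite sumr_const card_ord.
    apply: eq_bigr => j _.
    rewrite (bigD1 j) //= big1 => [|i ij].
      by rewrite mxE eqxx cabsE /= expr1n expr0n /= !addr0 sqrtr1 expr1n.
    by rewrite mxE (negbTE ij) cabsE /= expr0n /= addr0 sqrtr0 expr0n.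
  have : H^-1 * (2 * \sum_i \sum_j cabs (A i j) ^+ 2) <= 2.
    rewrite mulrCA -[leRHS]mulr1 ler_wpM2l // ler_pdivrMl // mulr1 //.
  have -> : (n%:R^-1 * (2 * n%:R) : R) = 2 by field; rewrite gt_eqF.
  lra.
have [W hW] := round_vector b (@quadratic_sqn_mulmx A H^-1 n%:R^-1) q00 s0 kap0 (fun x => q0 _).
have {}hW : q (b - s%:C%C *: word_vec R W) + s ^+ 2 / r * s * (size W)%:R <= 6 * s ^+ 2.
  apply: (le_trans hW); rewrite -/q.
  have h1 : s ^+ 2 * \sum_x q (axis_vec R x) <= s ^+ 2 * 4 by rewrite ler_wpM2l ?sqr_ge0.
  have h2 : s ^+ 2 / r * \sum_x `|axis_coord b x| <= s ^+ 2 / r * (2 * r).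
    by rewrite ler_wpM2l // sum_axis_coord.
  have h3 : s ^+ 2 / r * (2 * r) = 2 * s ^+ 2 by field; rewrite gt_eqF.
  move: h1 h2; rewrite h3 /q; lra.
have pen0 : 0 <= s ^+ 2 / r * s * (size W)%:R.
  by rewrite mulr_ge0 ?ler0n // mulr_ge0 // ltW.
exists W; move: hW; rewrite /q; move: (b - _) => err hW.
have X0 := mulr_ge0 (ltW Hi) (sqn_ge0 (A *m err)).
have Y0 := mulr_ge0 (ltW ni) (sqn_ge0 err).
move: (sqn (A *m err)) hW X0 => X; move: (sqn err) Y0 => Y Y0 hW X0; split.
- have : s ^+ 2 / r * s * (size W)%:R <= 6 * s ^+ 2 by lra.
  rewrite -ler_pdivlMl; last by rewrite mulr_gt0 // divr_gt0 // exprn_gt0.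
  by move/le_trans; apply; rewrite le_eqVlt; apply/orP; left; apply/eqP; field; rewrite !gt_eqF.
- by rewrite mulrC -ler_pdivrMl //; lra.
- by rewrite mulrC -ler_pdivrMl //; lra.
Qed.

(** The rows of [K] send the rounded vector to entries of size at most [t], and
    the rounding error is bounded over all the rows of [G] at once; together
    they bound [P_K N b] although nothing is known about [N b] row by row. *)
Lemma word_controls_rows N b (G : {set 'I_n}) (H s t : R) :
  (0 < n)%N -> 0 < H -> 0 < s -> 0 <= t ->
  \sum_(i in G) \sum_j cabs (N i j) ^+ 2 <= H -> l2norm b <= 1 ->
  exists W : seq (letter n),
    [/\ (size W)%:R <= 6 * Num.sqrt n%:R / s,
        sqn (s%:C%C *: word_vec R W) <= 2 + 12 * s ^+ 2 * n%:R
      & forall K : {set 'I_n}, K \subset G ->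
          (forall i, i \in K -> cabs ((N *m (s%:C%C *: word_vec R W)) i 0) <= t) ->
          sqn (coord_proj R K *m N *m b) <= 2 * n%:R * t ^+ 2 + 12 * s ^+ 2 * H].
Proof.
move=> n0 H0 s0 t0 NH b1.
have sqnD2 m (u v : 'cV[R[i]]_m) : sqn (u + v) <= 2 * sqn u + 2 * sqn v.
  by have := sqn_add_le u v (ltr01 : 0 < 1 :> R); rewrite invr1.
have AH : \sum_i \sum_j cabs ((coord_proj R G *m N) i j) ^+ 2 <= H.
  apply: le_trans NH; rewrite [leRHS]big_mkcond; apply: ler_sum => i _.
  case: ifP => iG; first by apply: ler_sum => j _; rewrite coord_projE iG.
  rewrite big1 // => j _; rewrite coord_projE iG.
  by rewrite cabsE /= expr0n /= addr0 sqrtr0 expr0n.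
have [W [sW bW AW]] := sparse_approximation n0 H0 s0 AH b1.
exists W; split => //.
  have -> : s%:C%C *: word_vec R W = b + - (b - s%:C%C *: word_vec R W).
    by rewrite opprB addrC subrK.
  apply: (le_trans (sqnD2 _ _ _)); rewrite -(sqr_l2norm (- _)) l2normN !sqr_l2norm.
  have : sqn b <= 1 by rewrite -sqr_l2norm expr_le1 // l2norm_ge0.
  move: bW; lra.
move=> K KG Kt; set b' := s%:C%C *: word_vec R W.
have -> : b = b' + (b - b') by rewrite addrC subrK.
rewrite mulmxDr; apply: (le_trans (sqnD2 _ _ _)).
have h1 : sqn (coord_proj R K *m N *m b') <= n%:R * t ^+ 2.
  rewrite -mulmxA sqn_coord_proj.
  apply: (@le_trans _ _ (\sum_(i in K) t ^+ 2)).
    by apply: ler_sum => i iK; rewrite ler_pXn2r ?nnegrE ?cabs_ge0 // Kt.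
  rewrite sumr_const -[leLHS]mulr_natl ler_wpM2r ?sqr_ge0 // ler_nat.
  by rewrite -[leqRHS]card_ord max_card.
have h2 : sqn (coord_proj R K *m N *m (b - b')) <= 6 * s ^+ 2 * H.
  apply: le_trans AW; rewrite -!mulmxA !sqn_coord_proj.
  rewrite [leRHS](big_setID K) /= (finset.setIidPr KG) lerDl.
  by apply: sumr_ge0 => i _; rewrite sqr_ge0.
have -> : 2 * n%:R * t ^+ 2 + 12 * s ^+ 2 * H = 2 * (n%:R * t ^+ 2) + 2 * (6 * s ^+ 2 * H).
  by ring.
by apply: lerD; rewrite ler_pM2l.
Qed.

End Net.

(** * Measurability and independence *)

Section ComplexMeasurability.
Context d (T : measurableType d) (R : realType).
Implicit Types f g : T -> R[i].

Definition cmeasurable f :=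
  measurable_fun setT (@complex.Re R \o f) /\ measurable_fun setT (@complex.Im R \o f).

Lemma complex_RV_cmeasurable f : complex_RV f <-> cmeasurable f.
Proof.
by rewrite /complex_RV /cmeasurable measurable_fun_pairP.
Qed.

Lemma cmeasurable_cst (c : R[i]) : cmeasurable (fun=> c).
Proof. by split; exact: measurable_cst. Qed.

Lemma cmeasurableD f g : cmeasurable f -> cmeasurable g -> cmeasurable (fun t => f t + g t).
Proof.
move=> [f1 f2] [g1 g2]; split.
  rewrite (_ : _ \o _ = (@complex.Re R \o f) \+ (@complex.Re R \o g)); last first.
    by apply/funext => t; rewrite /= ReD.
  exact: measurable_funD.
rewrite (_ : _ \o _ = (@complex.Im R \o f) \+ (@complex.Im R \o g)); last first.
  by apply/funext => t; rewrite /= ImD.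
exact: measurable_funD.
Qed.

Lemma cmeasurableM f g : cmeasurable f -> cmeasurable g -> cmeasurable (fun t => f t * g t).
Proof.
move=> [f1 f2] [g1 g2]; split.
  rewrite (_ : _ \o _ = ((@complex.Re R \o f) \* (@complex.Re R \o g))
                      \- ((@complex.Im R \o f) \* (@complex.Im R \o g))); last first.
    by apply/funext => t; rewrite /= ReM.
  by apply: measurable_funB; exact: measurable_funM.
rewrite (_ : _ \o _ = ((@complex.Re R \o f) \* (@complex.Im R \o g))
                      \+ ((@complex.Im R \o f) \* (@complex.Re R \o g))); last first.
  by apply/funext => t; rewrite /= ImM.
by apply: measurable_funD; exact: measurable_funM.
Qed.

Lemma cmeasurable_sum (I : Type) (r : seq I) (F : I -> T -> R[i]) :
  (forall i, cmeasurable (F i)) -> cmeasurable (fun t => \sum_(i <- r) F i t).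
Proof.
move=> mF; elim: r => [|i r IH].
  by under eq_fun do rewrite big_nil; exact: cmeasurable_cst.
by under eq_fun do rewrite big_cons; exact: cmeasurableD.
Qed.

Lemma measurable_sqrt (f : T -> R) :
  measurable_fun setT f -> measurable_fun setT (fun t => Num.sqrt (f t)).
Proof.
apply: (@measurableT_comp _ _ _ _ _ _ (@Num.sqrt R)).
by apply: continuous_measurable_fun; exact: sqrt_continuous.
Qed.

Lemma measurable_cabs f : cmeasurable f -> measurable_fun setT (fun t => cabs (f t)).
Proof.
move=> [f1 f2]; under eq_fun do rewrite cabsE.
apply: measurable_sqrt.
by apply: measurable_funD; apply: measurable_funX.
Qed.

Lemma measurable_l2norm m (f : T -> 'cV[R[i]]_m) :
  (forall i, cmeasurable (fun t => f t i 0)) -> measurable_fun setT (fun t => l2norm (f t)).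
Proof.
move=> mf; rewrite /l2norm; apply: measurable_sqrt.
by apply: measurable_sum => i; apply: measurable_funX; exact: measurable_cabs.
Qed.

Lemma cmeasurable_mulmx m n p (A : T -> 'M[R[i]]_(m, n)) (B : 'M[R[i]]_(n, p)) i j :
  (forall i j, cmeasurable (fun t => A t i j)) -> cmeasurable (fun t => (A t *m B) i j).
Proof.
move=> mA; under eq_fun do rewrite mxE.
by apply: cmeasurable_sum => k; apply: cmeasurableM => //; exact: cmeasurable_cst.
Qed.

Lemma cmeasurable_mulmxl m n p (B : 'M[R[i]]_(m, n)) (A : T -> 'M[R[i]]_(n, p)) i j :
  (forall i j, cmeasurable (fun t => A t i j)) -> cmeasurable (fun t => (B *m A t) i j).
Proof.
move=> mA; under eq_fun do rewrite mxE.
by apply: cmeasurable_sum => k; apply: cmeasurableM => //; exact: cmeasurable_cst.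
Qed.

Lemma measurable_le_cst (f : T -> R) (c : R) : measurable_fun setT f ->
  measurable [set t | f t <= c].
Proof.
move=> mf; rewrite -[X in measurable X]setTI.
by have := mf measurableT _ (measurable_itv `]-oo, c]); rewrite set_itvE /preimage /=.
Qed.

Lemma measurable_gt_cst (f : T -> R) (c : R) : measurable_fun setT f ->
  measurable [set t | c < f t].
Proof.
move=> mf; rewrite -[X in measurable X]setTI.
by have := mf measurableT _ (measurable_itv `]c, +oo[); rewrite set_itvE /preimage /=.
Qed.

End ComplexMeasurability.

Section Independence.
Context d (T : measurableType d) (R : realType) (P : probability T R).

Lemma bigsetIP (I : finType) (Q : pred I) (A : I -> set T) t :
  (\big[setI/setT]_(i | Q i) A i) t <-> forall i, Q i -> A i t.
Proof.
rewrite -bigcap_seq_cond; split => [h i Qi|h i /= /andP[_ Qi]]; last exact: h.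
by apply: h; rewrite /= mem_index_enum.
Qed.

(** The sigma-algebra generated by each system is reached one index at a time:
    with the other events fixed, the events that satisfy the product rule form
    a Dynkin system. *)
Lemma independent_sigma_algebras (I : finType) (G : I -> set (set T)) :
  (forall i, G i `<=` measurable) -> (forall i, setI_closed (G i)) ->
  (forall i, G i setT) ->
  (forall A : I -> set T, (forall i, G i (A i)) ->
     P (\big[setI/setT]_i A i) = (\prod_i P (A i))%E) ->
  forall A : I -> set T, (forall i, <<s G i>> (A i)) ->
     P (\big[setI/setT]_i A i) = (\prod_i P (A i))%E.
Proof.
move=> Gm GI GT Gprod A sA.
have sGm i : <<s G i>> `<=` @measurable _ T.
  by apply: smallest_sub; [exact: sigma_algebra_measurable|exact: Gm].
have Gs i : G i `<=` <<s G i>> by exact: sub_gen_smallest.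
suff: forall (r : seq I) (A : I -> set T),
    (forall i, <<s G i>> (A i)) -> (forall i, i \notin r -> G i (A i)) ->
    P (\big[setI/setT]_i A i) = (\prod_i P (A i))%E.
  by move=> /(_ (index_enum I) A sA); apply => i; rewrite mem_index_enum.
move=> {A sA}; elim => [|i0 r IH] A sA GA; first by apply: Gprod => i; exact: GA.
set B := \big[setI/setT]_(i | i != i0) A i.
have mB : measurable B by apply: bigsetI_measurable => i _; exact: (sGm i).
pose A' S := fun i => if i == i0 then S else A i.
have A'I S : \big[setI/setT]_i A' S i = S `&` B.
  rewrite (bigD1 i0) //= /A' eqxx; congr (_ `&` _).
  by apply: eq_bigr => i /negbTE ->.
have A'P S : (\prod_i P (A' S i) = P S * \prod_(i | i != i0) P (A i))%E.
  rewrite (bigD1 i0) //= /A' eqxx; congr (_ * _)%E.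
  by apply: eq_bigr => i /negbTE ->.
have GP S : G i0 S -> (P (S `&` B) = P S * \prod_(i | i != i0) P (A i))%E.
  move=> GS; rewrite -A'P -A'I; apply: IH => i; rewrite /A'.
    by case: eqP => [->|//]; exact: Gs.
  move=> ir; case: eqP => [->//|/eqP ii0]; apply: GA.
  by rewrite inE negb_or ii0.
have PB : P B = (\prod_(i | i != i0) P (A i))%E.
  by have := GP _ (GT i0); rewrite setTI probability_setT mul1e.
rewrite -PB in GP.
have Bfin : P B \is a fin_num by exact: fin_num_measure.
suff SP : forall S, <<s G i0>> S -> P (S `&` B) = (P S * P B)%E.
  by rewrite (bigD1 i0) //= [RHS](bigD1 i0) //= -PB; exact: SP.
have PC (S : set T) : measurable S -> P (S `&` B) = (P S * P B)%E ->
    P (~` S `&` B) = (P (~` S) * P B)%E.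
  move=> mS PS; transitivity (P B - P (S `&` B))%E.
    rewrite (setIC S) setIC -setDE measureD //.
    by rewrite (le_lt_trans (probability_le1 P mB)) // ltry.
  by rewrite PS probability_setC // muleBl ?mul1e.
have PU (F : (set T)^nat) : (forall k, measurable (F k)) -> trivIset [set: nat] F ->
    (forall k, P (F k `&` B) = (P (F k) * P B)%E) ->
    P (\bigcup_k F k `&` B) = (P (\bigcup_k F k) * P B)%E.
  move=> mF tF PF; rewrite setI_bigcupl.
  rewrite measure_bigcup //=; last 2 first.
  + by move=> k _; exact: measurableI.
  + apply/trivIsetP => i j _ _ ij; move/trivIsetP : tF => /(_ i j Logic.I Logic.I ij) Fij.
    by rewrite setIACA Fij set0I.
  under eq_eseriesr do rewrite PF.
  rewrite measure_bigcup //= muleC -(fineK Bfin).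
  under eq_eseriesr do rewrite muleC.
  by rewrite nneseriesZl.
apply: (@dynkin_induction _ (g_sigma_algebraType (G i0)) (G i0)
    (fun S => P (S `&` B) = (P S * P B)%E)) => //=.
- by rewrite setTI probability_setT mul1e.
- by move=> S /(sGm i0); exact: PC.
- by move=> F mF; apply: PU => k; apply: (sGm i0); exact: (mF k).
Qed.

End Independence.

(** * Rows of the random matrix and counting tails *)

Section Rows.
Context d (T : measurableType d) (R : realType) (P : probability T R).
Variables (n : nat) (N : T -> 'M[R[i]]_n).
Hypothesis mN : forall i j, complex_RV (fun t => N t i j).

(** A pi-system that generates the sigma-algebra of a row. *)
Definition row_rectangles (i : 'I_n) : set (set T) :=
  [set A | exists B : 'I_n -> set (R * R), (forall j, measurable (B j)) /\
     A = [set t | forall j, B j (C2RR (N t i j))]].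

Lemma measurable_entry_preimage i j (B : set (R * R)) : measurable B ->
  measurable ((@C2RR R \o (fun t => N t i j)) @^-1` B).
Proof. by move=> mB; rewrite -[X in measurable X]setTI; exact: (mN i j). Qed.

Lemma row_rectangles_measurable i : row_rectangles i `<=` measurable.
Proof.
move=> _ [B [mB ->]].
rewrite (_ : [set t | _] = \big[setI/setT]_(j < n)
    ((@C2RR R \o (fun t => N t i j)) @^-1` B j)).
  by apply: bigsetI_measurable => j _; exact: measurable_entry_preimage.
by apply/seteqP; split => t /=; [move=> h; apply/bigsetIP => j _; exact: h
  |move=> /bigsetIP h j; exact: (h j)].
Qed.

Lemma setI_closed_row_rectangles i : setI_closed (row_rectangles i).
Proof.
move=> _ _ [B [mB ->]] [C [mC ->]]; exists (fun j => B j `&` C j); split.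
  by move=> j; exact: measurableI.
apply/seteqP; split => t /=; first by move=> [h1 h2] j; split.
by move=> h; split => j; have [] := h j.
Qed.

Lemma row_rectanglesT i : row_rectangles i setT.
Proof.
by exists (fun=> setT); split => //; apply/seteqP; split.
Qed.

(** On rectangles the product rule for rows is the product rule for the
    entries; it extends to every event determined by a single row. *)
Lemma rows_independent (A : 'I_n -> set T) (S : {set 'I_n}) :
  mutually_independent P (fun (ij : 'I_n * 'I_n) t => N t ij.1 ij.2) ->
  (forall i, <<s row_rectangles i>> (A i)) ->
  P (\big[setI/setT]_(i in S) A i) = (\prod_(i in S) P (A i))%E.
Proof.
move=> indep sA.
pose A' i := if i \in S then A i else setT.
have -> : \big[setI/setT]_(i in S) A i = \big[setI/setT]_i A' i.
  by rewrite big_mkcond.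
have -> : (\prod_(i in S) P (A i) = \prod_i P (A' i))%E.
  rewrite big_mkcond; apply: eq_bigr => i _; rewrite /A'; case: ifP => // _.
  by rewrite probability_setT.
apply: (independent_sigma_algebras (G := row_rectangles)).
- exact: row_rectangles_measurable.
- exact: setI_closed_row_rectangles.
- exact: row_rectanglesT.
- move=> {A' sA A}A /choice[B BP].
  have rowP i : P (A i) = (\prod_j P ((@C2RR R \o (fun t => N t i j)) @^-1` B i j))%E.
    have := indep [set ij | ij.1 == i]%SET (fun ij => B ij.1 ij.2) (fun ij => (BP ij.1).1 ij.2).
    rewrite (_ : \bigcap_(_ in _) _ = A i); last first.
      rewrite (BP i).2; apply/seteqP; split => t /= h.
        by move=> j; apply: (h (i, j)); rewrite /= inE.
      by move=> [i' j] /=; rewrite inE /= => /eqP ->; exact: h.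
    move=> ->.
    rewrite (eq_bigl (fun ij => (ij.1 == i) && true)); last first.
      by move=> ij; rewrite inE andbT.
    by rewrite -(pair_big (pred1 i) predT (fun i j =>
      P ((@C2RR R \o (fun t => N t i j)) @^-1` B i j))) /= big_pred1_eq.
  have := indep [set: 'I_n * 'I_n]%SET (fun ij => B ij.1 ij.2) (fun ij => (BP ij.1).1 ij.2).
  rewrite (_ : \bigcap_(_ in _) _ = \big[setI/setT]_i A i); last first.
    apply/seteqP; split => t /= h.
      by apply/bigsetIP => i _; rewrite (BP i).2 /= => j; apply: (h (i, j)); rewrite /= inE.
    move=> [i j] _ /=; move/bigsetIP : h => /(_ i isT).
    by rewrite {1}(BP i).2; exact.
  move=> ->; rewrite (eq_bigl predT); last by move=> ij; rewrite inE.
  rewrite -(pair_bigA _ (fun i j => P ((@C2RR R \o (fun t => N t i j)) @^-1` B i j))) /=.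
  by apply: eq_bigr => i _; rewrite rowP.
- move=> i; rewrite /A'; case: ifP => // _.
  by apply: sub_gen_smallest; exact: row_rectanglesT.
Qed.

Lemma cmeasurable_row_entry i j :
  cmeasurable ((fun t => N t i j) : g_sigma_algebraType (row_rectangles i) -> R[i]).
Proof.
apply/complex_RV_cmeasurable => _ B mB; rewrite setTI.
apply: sub_gen_smallest; exists (fun k => if k == j then B else setT); split.
  by move=> k; case: ifP.
apply/seteqP; split => t /= h; last by have := h j; rewrite eqxx.
by move=> k; case: eqP => // ->.
Qed.

Lemma row_sigma_norm i (c : R) :
  <<s row_rectangles i>> [set t | c < \sum_j cabs (N t i j) ^+ 2].
Proof.
apply: (@measurable_gt_cst _ (g_sigma_algebraType (row_rectangles i)) R
  (fun t => \sum_j cabs (N t i j) ^+ 2) c).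
apply: measurable_sum => j; apply: measurable_funX.
exact: measurable_cabs (cmeasurable_row_entry i j).
Qed.

Lemma row_sigma_mulmx i (v : 'cV[R[i]]_n) (c : R) :
  <<s row_rectangles i>> [set t | c < cabs ((N t *m v) i 0)].
Proof.
apply: (@measurable_gt_cst _ (g_sigma_algebraType (row_rectangles i)) R
  (fun t => cabs ((N t *m v) i 0)) c).
apply: measurable_cabs; under eq_fun do rewrite mxE.
apply: cmeasurable_sum => j; apply: cmeasurableM; last exact: cmeasurable_cst.
exact: cmeasurable_row_entry.
Qed.

Lemma row_sigma_sub i : <<s row_rectangles i>> `<=` measurable.
Proof.
apply: smallest_sub; [exact: sigma_algebra_measurable|exact: row_rectangles_measurable].
Qed.

End Rows.

Section Markov.
Context d (T : measurableType d) (R : realType) (P : probability T R).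

Lemma measurable_ge_cst (f : T -> R) (c : R) : measurable_fun setT f ->
  measurable [set t | c <= f t].
Proof.
move=> mf; rewrite -[X in measurable X]setTI.
by have := mf measurableT _ (measurable_itv `[c, +oo[); rewrite set_itvE /preimage /=.
Qed.

Lemma markov_nonneg (f : T -> R) (a : R) : measurable_fun setT f ->
  (forall t, 0 <= f t) -> 0 <= a ->
  (a%:E * P [set t | a <= f t]%R <= \int[P]_t (f t)%:E)%E.
Proof.
move=> mf f0 a0; have mE := measurable_ge_cst a mf.
have -> : P [set t | a <= f t] = (\int[P]_t (\1_[set t | (a <= f t)%R] t)%:E)%E.
  by rewrite integral_indic // setIT.
rewrite -ge0_integralZl_EFin //=.
- apply: ge0_le_integral => //=.
  + by move=> t _; rewrite -EFinM lee_fin mulr_ge0.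
  + by apply: measurable_funeM; apply/measurable_EFinP.
  + exact/measurable_EFinP.
  + move=> t _; rewrite -EFinM lee_fin indicE.
    by case: (boolP (t \in _)) => [/set_mem /=|_]; rewrite ?mulr1 ?mulr0.
- exact/measurable_EFinP.
Qed.

End Markov.

Section Counting.
Context d (T : measurableType d) (R : realType) (P : probability T R).
Variable n : nat.

(** Chernoff's bound for the number of events that occur; the exponential of
    the number of occurrences expands as a sum over the subsets of indices, so
    that only the probabilities of intersections matter. *)
Lemma count_tail (A : 'I_n -> set T) (p x : R) : 0 <= p ->
  (forall i, measurable (A i)) ->
  (forall S : {set 'I_n}, (P (\big[setI/setT]_(i in S) A i) <= (p ^+ #|S|)%:E)%E) ->
  (P [set t | x <= #|[set i | t \in A i]%SET|%:R]%R
   <= (expR (- x + (expR 1 - 1) * p * n%:R))%:E)%E.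
Proof.
move=> p0 mA PA.
set c : R := expR 1 - 1.
have c0 : 0 <= c by rewrite subr_ge0 -expR0 ler_expR.
pose B (S : {set 'I_n}) := \big[setI/setT]_(i in S) A i.
have mB S : measurable (B S) by apply: bigsetI_measurable => i _; exact: mA.
pose f t : R := \sum_(S : {set 'I_n}) c ^+ #|S| * \1_(B S) t.
have fE t : f t = expR 1 ^+ #|[set i | t \in A i]%SET|.
  have -> : expR 1 ^+ #|[set i | t \in A i]%SET| =
      \prod_(i < n) (c * \1_(A i) t + 1) :> R.
    rewrite -prodr_const big_mkcond; apply: eq_bigr => i _.
    rewrite inE indicE; case: (t \in A i); rewrite ?mulr1 ?mulr0 ?add0r //.
    by rewrite subrK.
  rewrite bigA_distr /f; apply: eq_bigr => S _.
  rewrite [RHS](bigID (mem S)) /= [X in _ = _ * X]big1 ?mulr1; last first.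
    by move=> i /negbTE ->.
  under [RHS]eq_bigr => i iS do rewrite iS.
  rewrite big_split /= prodr_const; congr (_ * _).
  rewrite indicE; case: (boolP (t \in B S)) => [/set_mem/bigsetIP tS|tS].
    by rewrite big1 // => i iS; rewrite indicE mem_set //; exact: tS.
  apply/esym/eqP/prodf_eq0; apply: contrapT => tN; move/negP: tS; apply.
  apply/mem_set/bigsetIP => i iS; apply: contrapT => tAi; apply: tN.
  by exists i => //; rewrite indicE memNset.
have mf : measurable_fun setT f.
  by apply: measurable_sum => S; apply: measurable_funM.
have f0 t : 0 <= f t by rewrite fE exprn_ge0 // expR_ge0.
have -> : [set t | x <= #|[set i | t \in A i]%SET|%:R] = [set t | expR x <= f t].
  by apply/seteqP; split => t /=; rewrite fE -expRM_natl mulr1 ler_expR.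
rewrite expRD expRN EFinM lee_pdivlMl ?expR_gt0 //.
apply: (le_trans (markov_nonneg P mf f0 (expR_ge0 x))).
have -> : (\int[P]_t (f t)%:E = \sum_(S : {set 'I_n}) (c ^+ #|S|)%:E * P (B S))%E.
  under eq_integral do rewrite /f -sumEFin.
  rewrite ge0_integral_sum //=; last 2 first.
  - by move=> S; apply/measurable_EFinP; apply: measurable_funM.
  - by move=> S t _; rewrite lee_fin mulr_ge0 ?exprn_ge0.
  apply: eq_bigr => S _; under eq_integral do rewrite EFinM.
  rewrite ge0_integralZl_EFin ?exprn_ge0 //; last exact/measurable_EFinP.
  by rewrite integral_indic // setIT.
apply: (@le_trans _ _ (\sum_(S : {set 'I_n}) ((c * p) ^+ #|S|)%:E)%E).
  apply: lee_sum => S _; rewrite exprMn EFinM; apply: lee_wpmul2l; last exact: PA.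
  by rewrite lee_fin exprn_ge0.
rewrite sumEFin lee_fin.
have -> : \sum_(S : {set 'I_n}) (c * p) ^+ #|S| = (c * p + 1) ^+ n.
  rewrite -[in RHS](card_ord n) -prodr_const bigA_distr; apply: eq_bigr => S _.
  rewrite [RHS](bigID (mem S)) /= [X in _ = _ * X]big1 ?mulr1; last first.
    by move=> i /negbTE ->.
  under [RHS]eq_bigr => i iS do rewrite iS.
  by rewrite prodr_const.
rewrite [_ * n%:R]mulrC expRM_natl; apply: lerXn2r; rewrite ?nnegrE ?expR_ge0 //.
  by rewrite addr_ge0 // mulr_ge0.
by rewrite addrC expR_ge1Dx.
Qed.

End Counting.

(** * Second moments *)

Section SecondMoments.
Context d (T : measurableType d) (R : realType) (P : probability T R).
Implicit Types U V : T -> R.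

(** The joint law of [U] and [V] is the product of their laws, so Fubini's
    theorem applies. *)
Lemma integral_mul_independent U V :
  measurable_fun setT U -> measurable_fun setT V ->
  (forall A B, measurable A -> measurable B ->
     P (U @^-1` A `&` V @^-1` B) = (P (U @^-1` A) * P (V @^-1` B))%E) ->
  P.-integrable setT (EFin \o U) -> P.-integrable setT (EFin \o V) ->
  P.-integrable setT (EFin \o (U \* V)) ->
  (\int[P]_t (U t * V t)%:E = \int[P]_t (U t)%:E * \int[P]_t (V t)%:E)%E.
Proof.
move=> mU mV indep iU iV iUV.
pose X : {mfun T >-> R} := HB.pack U (isMeasurableFun.Build _ _ _ _ U mU).
pose Y : {mfun T >-> R} := HB.pack V (isMeasurableFun.Build _ _ _ _ V mV).
have mW : measurable_fun setT (fun t => (U t, V t)) by exact: measurable_fun_pair.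
pose W : {mfun T >-> (R * R)%type} := HB.pack (fun t => (U t, V t))
  (isMeasurableFun.Build _ _ _ _ (fun t => (U t, V t)) mW).
pose f (w : R * R) : \bar R := (w.1 * w.2)%:E.
have mf : measurable_fun setT f.
  by apply/measurable_EFinP; apply: measurable_funM; [exact: measurable_fst|exact: measurable_snd].
have lawE A : measurable A -> (distribution P X \x distribution P Y)%E A = distribution P W A.
  apply: product_measure_unique => B C mB mC; rewrite /distribution /pushforward /= -indep //.
have iWf : (distribution P W).-integrable setT f.
  by apply: integrable_pushforward => //.
have iprod : (distribution P X \x distribution P Y)%E.-integrable setT f.
  apply/integrableP; split => //; move/integrableP : iWf => [_].
  by rewrite [X in (X < _ -> _)%E](eq_measure_integral (distribution P X \x distribution P Y)%E) // => A mA _; exact: (esym (lawE A mA)).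
transitivity (\int[distribution P W]_w f w)%E.
  by rewrite integral_distribution.
rewrite (eq_measure_integral (distribution P X \x distribution P Y)%E); last first.
  by move=> A mA _; exact: (esym (lawE A mA)).
rewrite -integral12_prod_meas1 // /fubini_F /f /=.
have iX : (distribution P X).-integrable setT EFin by apply: integrable_pushforward.
have iY : (distribution P Y).-integrable setT EFin by apply: integrable_pushforward.
have intX : (\int[distribution P X]_x x%:E = \int[P]_t (U t)%:E)%E.
  by rewrite integral_distribution.
have intY : (\int[distribution P Y]_x x%:E = \int[P]_t (V t)%:E)%E.
  by rewrite integral_distribution.
rewrite -intX -intY.
have fY : (\int[distribution P Y]_x x%:E \is a fin_num)%E by exact: integrable_fin_num.
rewrite -[in RHS](fineK fY) -integralZr //.
by apply: eq_integral => x _; rewrite fineK // -integralZl.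
Qed.

(** Pythagoras: the cross terms vanish because the summands are centred and
    pairwise independent. *)
Lemma integral_sum_sqr (I : finType) (p : I -> T -> R) :
  (forall i, P.-integrable setT (EFin \o p i)) ->
  (forall i, P.-integrable setT (fun t => (p i t ^+ 2)%:E)) ->
  (forall i, \int[P]_t (p i t)%:E = 0)%E ->
  (forall i j A B, i != j -> measurable A -> measurable B ->
     P (p i @^-1` A `&` p j @^-1` B) = (P (p i @^-1` A) * P (p j @^-1` B))%E) ->
  (\int[P]_t ((\sum_i p i t) ^+ 2)%:E = \sum_i \int[P]_t (p i t ^+ 2)%:E)%E.
Proof.
move=> ip ip2 p0 indep.
have mp i : measurable_fun setT (p i) by apply/measurable_EFinP; exact: measurable_int (ip i).
have ipp i j : P.-integrable setT (fun t => (p i t * p j t)%:E).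
  apply: (@le_integrable _ _ _ P setT _ _ (fun t => (p i t ^+ 2)%:E + (p j t ^+ 2)%:E)%E) => //.
  - by apply/measurable_EFinP; exact: measurable_funM.
  - move=> t _; rewrite -EFinD !abse_EFin lee_fin [leRHS]ger0_norm ?addr_ge0 ?sqr_ge0 //.
    rewrite ler_norml; move: (p i t) (p j t) => x y.
    have := sqr_ge0 (x + y); have := sqr_ge0 (x - y); have := sqr_ge0 x; have := sqr_ge0 y.
    by move=> *; apply/andP; split; nra.
  - exact: integrableD.
have -> : (\int[P]_t ((\sum_i p i t) ^+ 2)%:E =
   \int[P]_t (\sum_i \sum_j (p i t * p j t)%:E))%E.
  apply: eq_integral => t _; rewrite expr2 mulr_suml -sumEFin; apply: eq_bigr => i _.
  by rewrite mulr_sumr -sumEFin.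
rewrite integral_sum //=; last by move=> i; exact: integrable_sum.
apply: eq_bigr => i _; rewrite integral_sum //= (bigD1 i) //= big1 ?adde0.
  by apply: eq_integral => t _; rewrite expr2.
move=> j ji; rewrite integral_mul_independent ?p0 ?mul0e //; first last.
  exact: ipp.
by move=> A B mA mB; apply: indep => //; rewrite eq_sym.
Qed.

End SecondMoments.

Section Transfer.
Context d (T : measurableType d) d0 (T0 : measurableType d0) (R : realType).
Variables (P : probability T R) (P0 : probability T0 R) (X : T -> R[i]) (Z : T0 -> R[i]).
Hypotheses (mX : complex_RV X) (mZ : complex_RV Z) (lawXZ : same_law P P0 X Z).

Let X' : {mfun T >-> (R * R)%type} := HB.pack (@C2RR R \o X) (isMeasurableFun.Build _ _ _ _ _ mX).
Let Z' : {mfun T0 >-> (R * R)%type} := HB.pack (@C2RR R \o Z) (isMeasurableFun.Build _ _ _ _ _ mZ).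

(** Both integrals are integrals against the common law on the plane. *)
Lemma same_law_ge0_integral (f : R * R -> \bar R) :
  measurable_fun setT f -> (forall x, 0 <= f x)%E ->
  (\int[P]_t f (C2RR (X t)) = \int[P0]_t f (C2RR (Z t)))%E.
Proof.
move=> mf f0; transitivity (\int[distribution P X']_x f x)%E.
  by rewrite ge0_integral_distribution.
transitivity (\int[distribution P0 Z']_x f x)%E; last by rewrite ge0_integral_distribution.
by apply: eq_measure_integral => A mA _; exact: lawXZ.
Qed.

Lemma same_law_integrable (f : R * R -> \bar R) : measurable_fun setT f ->
  P0.-integrable setT (fun t => f (C2RR (Z t))) ->
  P.-integrable setT (fun t => f (C2RR (X t))).
Proof.
move=> mf /integrableP[_ fZ]; apply/integrableP; split.
  exact: (measurableT_comp mf mX).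
rewrite (same_law_ge0_integral (f := abse \o f)) //=.
exact: measurableT_comp.
Qed.

Lemma same_law_integral (f : R * R -> \bar R) : measurable_fun setT f ->
  P0.-integrable setT (fun t => f (C2RR (Z t))) ->
  (\int[P]_t f (C2RR (X t)) = \int[P0]_t f (C2RR (Z t)))%E.
Proof.
move=> mf iZ; transitivity (\int[distribution P X']_x f x)%E.
  by rewrite integral_distribution //; exact: same_law_integrable.
transitivity (\int[distribution P0 Z']_x f x)%E; last by rewrite integral_distribution.
by apply: eq_measure_integral => A mA _; exact: lawXZ.
Qed.

End Transfer.

Section EntryMoments.
Context d (T : measurableType d) d0 (T0 : measurableType d0) (R : realType).
Variables (P : probability T R) (P0 : probability T0 R) (z : T0 -> R[i]).
Hypotheses (mz : complex_RV z) (iz : complex_integrable P0 z)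
  (z0 : complex_mean P0 z = 0) (z1 : complex_variance P0 z = 1%E).

Lemma complex_mean0 : (\int[P0]_t (complex.Re (z t))%:E = 0)%E /\
  (\int[P0]_t (complex.Im (z t))%:E = 0)%E.
Proof.
case: iz => iR iI; move: z0; rewrite /complex_mean unlock => -[] hR hI.
by split; [rewrite -[LHS]fineK ?hR //|rewrite -[LHS]fineK ?hI //]; exact: integrable_fin_num.
Qed.

Lemma complex_variance1 : (\int[P0]_t (cabs (z t) ^+ 2)%:E = 1)%E.
Proof.
rewrite -z1 /complex_variance z0 unlock; apply: eq_integral => t _.
by rewrite subr0.
Qed.

Variables (n : nat) (N : T -> 'M[R[i]]_n).
Hypothesis iid : iid_matrix P P0 N z.

Lemma iid_complex_RV i j : complex_RV (fun t => N t i j).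
Proof. by case: iid. Qed.

Lemma iid_cmeasurable i j : cmeasurable (fun t => N t i j).
Proof. by apply/complex_RV_cmeasurable; exact: iid_complex_RV. Qed.

Lemma integrable_entry i j :
  P.-integrable setT (fun t => (complex.Re (N t i j))%:E) /\
  P.-integrable setT (fun t => (complex.Im (N t i j))%:E).
Proof.
case: iid => _ law _; case: iz => iR iI; split.
  apply: (same_law_integrable (iid_complex_RV i j) mz (law i j) (f := fun x => x.1%:E)) => //.
  by apply/measurable_EFinP; exact: measurable_fst.
apply: (same_law_integrable (iid_complex_RV i j) mz (law i j) (f := fun x => x.2%:E)) => //.
by apply/measurable_EFinP; exact: measurable_snd.
Qed.

Lemma integral_entry i j :
  (\int[P]_t (complex.Re (N t i j))%:E = 0)%E /\ (\int[P]_t (complex.Im (N t i j))%:E = 0)%E.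
Proof.
case: iid => _ law _; case: iz => iR iI; have [hR hI] := complex_mean0; split.
  rewrite -hR.
  apply: (same_law_integral (iid_complex_RV i j) mz (law i j) (f := fun x => x.1%:E)) => //.
  by apply/measurable_EFinP; exact: measurable_fst.
rewrite -hI.
apply: (same_law_integral (iid_complex_RV i j) mz (law i j) (f := fun x => x.2%:E)) => //.
by apply/measurable_EFinP; exact: measurable_snd.
Qed.

Lemma integral_entry_sqr i j : (\int[P]_t (cabs (N t i j) ^+ 2)%:E = 1)%E.
Proof.
case: iid => _ law _; rewrite -complex_variance1.
pose f (x : R * R) := (x.1 ^+ 2 + x.2 ^+ 2)%:E.
have := same_law_ge0_integral (iid_complex_RV i j) mz (law i j) (f := f).
rewrite /f /=; under eq_integral do rewrite -sqr_cabs.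
under [X in _ -> _ -> _ = X]eq_integral do rewrite -sqr_cabs.
apply; last by move=> x; rewrite lee_fin addr_ge0 // sqr_ge0.
apply/measurable_EFinP; apply: measurable_funD; apply: measurable_funX.
  exact: measurable_fst.
exact: measurable_snd.
Qed.

Lemma integrable_entry_sqr i j : P.-integrable setT (fun t => (cabs (N t i j) ^+ 2)%:E).
Proof.
apply/integrableP; split.
  by apply/measurable_EFinP; apply: measurable_funX; apply: measurable_cabs; exact: iid_cmeasurable.
under eq_integral do rewrite abse_EFin ger0_norm ?sqr_ge0 //.
by rewrite integral_entry_sqr ltry.
Qed.

Lemma integral_row_sqr i : (\int[P]_t (\sum_j cabs (N t i j) ^+ 2)%:E = n%:R%:E)%E.
Proof.
under eq_integral do rewrite -sumEFin.
rewrite integral_sum //=; last by move=> j; exact: integrable_entry_sqr.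
under eq_bigr do rewrite integral_entry_sqr.
by rewrite sumEFin sumr_const card_ord.
Qed.

Lemma entries_pairwise_independent i j k (A B : set (R * R)) : j != k ->
  measurable A -> measurable B ->
  (P ((fun t => C2RR (N t i j)) @^-1` A `&` (fun t => C2RR (N t i k)) @^-1` B) =
   P ((fun t => C2RR (N t i j)) @^-1` A) * P ((fun t => C2RR (N t i k)) @^-1` B))%E.
Proof.
move=> jk mA mB; case: iid => _ _ indep.
have := indep [set (i, j); (i, k)]%SET (fun ij => if ij.2 == j then A else B).
have ijk : (i, j) != (i, k) by apply: contra_neq jk => -[].
rewrite big_setU1 /=; last by rewrite inE.
rewrite big_set1 /= eqxx eq_sym (negbTE jk).
rewrite (_ : \bigcap_(_ in _) _ = (fun t => C2RR (N t i j)) @^-1` A `&` (fun t => C2RR (N t i k)) @^-1` B).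
  by apply => ij; case: ifP.
apply/seteqP; split => t /= h.
  have h1 := h (i, j); have h2 := h (i, k); move: h1 h2.
  rewrite /= !inE !eqxx /= orbT eq_sym (negbTE jk) => h1 h2.
  by split; [exact: h1|exact: h2].
move=> ij /=; rewrite !inE => /orP[] /eqP -> /=; first by rewrite eqxx; case: h.
by rewrite eq_sym (negbTE jk); case: h.
Qed.

(** Real linear functionals of the entries cover the real and the imaginary
    part of [x v_j] at the same time, which reduces the complex variance to the
    real one. *)
Lemma integral_linear_form_sqr i (f : 'I_n -> R * R -> R) (c e : 'I_n -> R) :
  (forall j x, f j x = c j * x.1 + e j * x.2) ->
  (\int[P]_t ((\sum_j f j (C2RR (N t i j))) ^+ 2)%:E =
   \sum_j \int[P]_t (f j (C2RR (N t i j)) ^+ 2)%:E)%E.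
Proof.
move=> fE.
have mf j : measurable_fun setT (f j).
  rewrite (_ : f j = fun x => c j * x.1 + e j * x.2); last by apply/funext => x; rewrite fE.
  by apply: measurable_funD; apply: measurable_funM.
have mfN j : measurable_fun setT (fun t => f j (C2RR (N t i j))).
  exact: (measurableT_comp (mf j) (iid_complex_RV i j)).
have fN j t : (f j (C2RR (N t i j)))%:E =
    ((c j)%:E * (complex.Re (N t i j))%:E + (e j)%:E * (complex.Im (N t i j))%:E)%E.
  by rewrite fE.
have [iR iI] : (forall j, P.-integrable setT (fun t => (complex.Re (N t i j))%:E)) /\
  (forall j, P.-integrable setT (fun t => (complex.Im (N t i j))%:E)).
  by split => j; have [] := integrable_entry i j.
apply: (integral_sum_sqr (p := fun j t => f j (C2RR (N t i j)))).
- move=> j; apply: (eq_integrable measurableT _ _ (fun t _ => esym (fN j t))).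
  by apply: integrableD => //; apply: integrableZl.
- move=> j.
  apply: (@le_integrable _ _ _ P setT _ _
    (fun t => ((c j ^+ 2 + e j ^+ 2)%:E * (cabs (N t i j) ^+ 2)%:E)%E)) => //.
  + by apply/measurable_EFinP; exact: measurable_funX.
  + move=> t _; rewrite -EFinM !abse_EFin lee_fin.
    rewrite ger0_norm ?sqr_ge0 // ger0_norm; last first.
      by rewrite mulr_ge0 ?addr_ge0 ?sqr_ge0.
    rewrite sqr_cabs fE /=; move: (c j) (e j) (complex.Re _) (complex.Im _) => a b x y.
    by have := sqr_ge0 (a * y - b * x); nra.
  + by apply: integrableZl => //; exact: integrable_entry_sqr.
- move=> j; under eq_integral do rewrite fN.
  have [hR hI] := integral_entry i j.
  by rewrite integralD ?integralZl ?hR ?hI ?mule0 ?adde0 //; exact: integrableZl.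
- move=> j k A B jk mA mB.
  apply: (entries_pairwise_independent i (A := f j @^-1` A) (B := f k @^-1` B)) => //.
    by rewrite -[X in measurable X]setTI; exact: mf.
  by rewrite -[X in measurable X]setTI; exact: mf.
Qed.

Lemma integral_mulmx_sqr i (v : 'cV[R[i]]_n) :
  (\int[P]_t (cabs ((N t *m v) i 0) ^+ 2)%:E = (sqn v)%:E)%E.
Proof.
pose p j (x : R * R) : R := complex.Re (v j 0) * x.1 + (- complex.Im (v j 0)) * x.2.
pose q j (x : R * R) : R := complex.Im (v j 0) * x.1 + complex.Re (v j 0) * x.2.
have E t : (cabs ((N t *m v) i 0) ^+ 2)%:E =
   (((\sum_j p j (C2RR (N t i j))) ^+ 2)%:E + ((\sum_j q j (C2RR (N t i j))) ^+ 2)%:E)%E.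
  rewrite -EFinD sqr_cabs mxE Re_sum Im_sum; congr ((_ ^+ 2 + _ ^+ 2)%:E);
    apply: eq_bigr => j _; rewrite ?ReM ?ImM /p /q /=; ring.
have mlin (c e : 'I_n -> R) : measurable_fun setT
    (fun t => (\sum_j (c j * complex.Re (N t i j) + e j * complex.Im (N t i j)))).
  apply: measurable_sum => j; have [mR mI] := iid_cmeasurable i j.
  by apply: measurable_funD; apply: measurable_funM.
under eq_integral do rewrite E.
rewrite ge0_integralD //=; first last.
- by apply/measurable_EFinP; apply: measurable_funX; exact: mlin.
- by move=> t _; rewrite lee_fin sqr_ge0.
- by apply/measurable_EFinP; apply: measurable_funX; exact: mlin.
- by move=> t _; rewrite lee_fin sqr_ge0.
rewrite (integral_linear_form_sqr i (fun j x => erefl (p j x))).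
rewrite (integral_linear_form_sqr i (fun j x => erefl (q j x))).
rewrite -big_split /= /sqn -sumEFin; apply: eq_bigr => j _.
have [mR mI] := iid_cmeasurable i j.
have mlin1 (c e : R) : measurable_fun setT
    (fun t => ((c * complex.Re (N t i j) + e * complex.Im (N t i j)) ^+ 2)%:E).
  apply/measurable_EFinP; apply: measurable_funX.
  by apply: measurable_funD; apply: measurable_funM.
rewrite -ge0_integralD //=; first last.
- exact: mlin1.
- by move=> t _; rewrite lee_fin sqr_ge0.
- exact: mlin1.
- by move=> t _; rewrite lee_fin sqr_ge0.
transitivity (\int[P]_t ((complex.Re (v j 0) ^+ 2 + complex.Im (v j 0) ^+ 2)%:E *
   (cabs (N t i j) ^+ 2)%:E))%E.
  apply: eq_integral => t _; rewrite -EFinD -EFinM sqr_cabs /p /q /=; congr (_%:E); ring.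
rewrite ge0_integralZl_EFin ?integral_entry_sqr ?mule1 //.
- by move=> t _; rewrite lee_fin sqr_ge0.
- by apply/measurable_EFinP; apply: measurable_funX; apply: measurable_cabs.
- by rewrite addr_ge0 // sqr_ge0.
Qed.

Lemma row_norm_tail i (c : R) : 0 < c ->
  (P [set t | c < \sum_j cabs (N t i j) ^+ 2]%R <= (n%:R / c)%:E)%E.
Proof.
move=> c0; have mf : measurable_fun setT (fun t => \sum_j cabs (N t i j) ^+ 2).
  by apply: measurable_sum => j; apply: measurable_funX; apply: measurable_cabs; exact: iid_cmeasurable.
have f0 t : 0 <= \sum_j cabs (N t i j) ^+ 2 by apply: sumr_ge0 => j _; exact: sqr_ge0.
have := markov_nonneg P mf f0 (ltW c0).
rewrite integral_row_sqr mulrC EFinM -lee_pdivlMl //; apply: le_trans.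
apply: le_measure; rewrite ?inE.
- exact: measurable_gt_cst.
- exact: measurable_ge_cst.
- by move=> t /= /ltW.
Qed.

Lemma mulmx_tail i (v : 'cV[R[i]]_n) (c : R) : 0 < c ->
  (P [set t | c < cabs ((N t *m v) i 0)]%R <= (sqn v / c ^+ 2)%:E)%E.
Proof.
move=> c0; have mf' : measurable_fun setT (fun t => cabs ((N t *m v) i 0)).
  by apply: measurable_cabs; apply: cmeasurable_mulmx; exact: iid_cmeasurable.
have mf : measurable_fun setT (fun t => cabs ((N t *m v) i 0) ^+ 2) by exact: measurable_funX.
have := markov_nonneg P mf (fun t => sqr_ge0 _) (sqr_ge0 c).
have c2 : 0 < c ^+ 2 by rewrite exprn_gt0.
rewrite integral_mulmx_sqr mulrC EFinM -lee_pdivlMl //; apply: le_trans.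
apply: le_measure; rewrite ?inE.
- exact: measurable_gt_cst.
- exact: measurable_ge_cst.
- by move=> t /= h; rewrite ler_pXn2r ?nnegrE ?cabs_ge0 ?ltW.
Qed.

End EntryMoments.

(** * Measurability of existential events *)

Section ExistentialMeasurability.
Context d (T : measurableType d) (R : realType).

Lemma rational_vector_near m (x : 'rV[R]_m) (e : R) : 0 < e ->
  exists r : 'rV[rat]_m, ball x e (map_mx (@ratr R) r).
Proof.
move=> e0.
have /choice[r rP] (j : 'I_m) : exists q : rat, `|x 0 j - ratr q| < e.
  have [q] := @rat_in_itvoo R (x 0 j - e) (x 0 j + e) ltac:(lra).
  by rewrite in_itv /= => /andP[q1 q2]; exists q; rewrite ltr_norml; apply/andP; split; lra.
exists (\row_j r j); split => // i j; rewrite !mxE ord1.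
exact: rP.
Qed.

(** Compactness turns the existential over an uncountable set into countable
    operations: near-solutions with rational coordinates at every precision
    already force an exact solution. *)
Lemma measurable_exists_nonpos m (Phi : T -> 'rV[R]_m -> R) (B : R) :
  (forall x, measurable_fun setT (Phi ^~ x)) ->
  (forall t, continuous (Phi t)) ->
  (forall t x, Phi t x <= 1 -> `|x| <= B) ->
  measurable [set t | exists x, Phi t x <= 0].
Proof.
move=> mPhi cPhi bPhi.
rewrite (_ : [set t | _] = \bigcap_k \bigcup_(r : 'rV[rat]_m)
   [set t | Phi t (map_mx (@ratr R) r) <= k.+1%:R^-1]).
  apply: bigcapT_measurable => k; apply: countable_bigcupT_measurable.
    exact: countableP.
  by move=> r; apply: measurable_le_cst; exact: mPhi.
apply/seteqP; split => t /=.
  move=> [x x0] k _.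
  have k0 : 0 < k.+1%:R^-1 :> R by rewrite invr_gt0 ltr0n.
  have /nbhs_ballP[e /= e0 eb] : nbhs x (Phi t @^-1` [set y | y < k.+1%:R^-1]).
    by apply: cPhi; apply: open_nbhs_nbhs; split; [exact: open_lt|exact: le_lt_trans k0].
  have [r xr] := rational_vector_near x e0.
  by exists r => //=; apply: ltW; exact: (eb _ xr).
move=> h; pose A : set 'rV[R]_m := [set x | `|x| <= B].
have small k : exists2 x, A x & Phi t x <= k.+1%:R^-1.
  have [r _ /= rk] := h k Logic.I; exists (map_mx (@ratr R) r) => //.
  by apply: (bPhi t); apply: (le_trans rk); rewrite invf_le1 ?ltr0n // ler1n.
have A0 : A !=set0 by have [x Ax _] := small 0%N; exists x.
have cA : compact A.
  apply: bounded_closed_compact.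
    exists B; split; first exact: num_real.
    by move=> y By x /= /le_trans; apply; exact: ltW.
  apply: (@closed_comp _ _ (fun x : 'rV[R]_m => `|x|) [set y : R | y <= B]).
    by move=> x _; exact: norm_continuous.
  exact: closed_le.
have [c cA' minc] := EVT_min_rV A0 cA (continuous_subspaceT (cPhi t)).
exists c; rewrite leNgt; apply/negP => c0.
have [k] := ltr_add_invr c0; rewrite add0r => kc.
have [x Ax xk] := small k.
have := minc x (mem_set Ax); rewrite leNgt => /negP; apply.
exact: le_lt_trans xk kc.
Qed.

End ExistentialMeasurability.

Section ComplexContinuity.
Context (S : topologicalType) (R : realType).
Implicit Types f g : S -> R[i].

Definition ccontinuous f :=
  continuous (@complex.Re R \o f : S -> R) /\ continuous (@complex.Im R \o f : S -> R).

Lemma ccontinuous_cst (c : R[i]) : ccontinuous (fun=> c).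
Proof. by split => x; exact: cvg_cst. Qed.

Lemma ccontinuousD f g : ccontinuous f -> ccontinuous g -> ccontinuous (fun t => f t + g t).
Proof.
move=> [f1 f2] [g1 g2]; split.
  rewrite (_ : _ \o _ = fun t => complex.Re (f t) + complex.Re (g t)).
    by move=> x; apply: cvgD; [exact: f1|exact: g1].
  by apply/funext => t; rewrite /= ReD.
rewrite (_ : _ \o _ = fun t => complex.Im (f t) + complex.Im (g t)).
  by move=> x; apply: cvgD; [exact: f2|exact: g2].
by apply/funext => t; rewrite /= ImD.
Qed.

Lemma ccontinuousM f g : ccontinuous f -> ccontinuous g -> ccontinuous (fun t => f t * g t).
Proof.
move=> [f1 f2] [g1 g2]; split.
  rewrite (_ : _ \o _ = fun t => complex.Re (f t) * complex.Re (g t)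
      - complex.Im (f t) * complex.Im (g t)).
    move=> x; apply: cvgB; apply: cvgM; [exact: f1|exact: g1|exact: f2|exact: g2].
  by apply/funext => t; rewrite /= ReM.
rewrite (_ : _ \o _ = fun t => complex.Re (f t) * complex.Im (g t)
   + complex.Im (f t) * complex.Re (g t)).
  by move=> x; apply: cvgD; apply: cvgM; [exact: f1|exact: g2|exact: f2|exact: g1].
by apply/funext => t; rewrite /= ImM.
Qed.

Lemma continuous_addr (f g : S -> R) :
  continuous f -> continuous g -> continuous (fun x => f x + g x).
Proof. by move=> cf cg x; apply: cvgD; [exact: cf|exact: cg]. Qed.

Lemma continuous_subr (f g : S -> R) :
  continuous f -> continuous g -> continuous (fun x => f x - g x).
Proof. by move=> cf cg x; apply: cvgB; [exact: cf|exact: cg]. Qed.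

Lemma continuous_sum_real (I : Type) (r : seq I) (F : I -> S -> R) :
  (forall i, continuous (F i)) -> continuous (fun t => \sum_(i <- r) F i t).
Proof.
move=> cF; elim: r => [|i r IH].
  by under eq_fun do rewrite big_nil; move=> x; exact: cvg_cst.
by under eq_fun do rewrite big_cons; move=> x; apply: cvgD; [exact: cF|exact: IH].
Qed.

Lemma ccontinuous_sum (I : Type) (r : seq I) (F : I -> S -> R[i]) :
  (forall i, ccontinuous (F i)) -> ccontinuous (fun t => \sum_(i <- r) F i t).
Proof.
move=> cF; elim: r => [|i r IH].
  by under eq_fun do rewrite big_nil; exact: ccontinuous_cst.
by under eq_fun do rewrite big_cons; exact: ccontinuousD.
Qed.

Lemma continuous_normr_comp (f : S -> R) :
  continuous f -> continuous (fun x => `|f x|).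
Proof. by move=> cf x; apply: cvg_norm; exact: cf. Qed.

Lemma continuous_scale (c : R) (f : S -> R) :
  continuous f -> continuous (fun x => c * f x).
Proof. by move=> cf x; apply: cvgM; [exact: cvg_cst|exact: cf]. Qed.

Lemma continuous_sqrt_comp (f : S -> R) :
  continuous f -> continuous (fun t => Num.sqrt (f t)).
Proof.
by move=> cf x; apply: (continuous_comp (f := f) (g := @Num.sqrt R));
  [exact: cf|exact: sqrt_continuous].
Qed.

Lemma continuous_sqr (f : S -> R) : continuous f -> continuous (fun t => f t ^+ 2).
Proof.
move=> cf; rewrite (_ : (fun t => f t ^+ 2) = fun t => f t * f t).
  by move=> x; apply: cvgM; exact: cf.
by apply/funext => t; rewrite expr2.
Qed.

Lemma continuous_cabs f : ccontinuous f -> continuous (fun t => cabs (f t)).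
Proof.
move=> [f1 f2]; rewrite (_ : (fun t => _) =
    fun t => Num.sqrt (complex.Re (f t) ^+ 2 + complex.Im (f t) ^+ 2)).
  apply: continuous_sqrt_comp => x.
  by apply: cvgD; [exact: (continuous_sqr f1)|exact: (continuous_sqr f2)].
by apply/funext => t; rewrite cabsE.
Qed.

Lemma continuous_l2norm m (f : S -> 'cV[R[i]]_m) :
  (forall i, ccontinuous (fun t => f t i 0)) -> continuous (fun t => l2norm (f t)).
Proof.
move=> cf; apply: continuous_sqrt_comp; apply: continuous_sum_real => i.
by apply: continuous_sqr; exact: continuous_cabs.
Qed.

End ComplexContinuity.

(** * Measurability of the two events *)

Section Gamma2Description.
Variable R : realType.

Lemma dist_lt n (x : 'cV[R[i]]_n) (A : set 'cV[R[i]]_n) (c : R) : A !=set0 ->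
  dist x A < c <-> exists2 y, A y & l2norm (x - y) < c.
Proof.
move=> [y0 Ay0]; have hl : has_lbound [set l2norm (x - y) | y in A].
  by exists 0 => _ [y _ <-]; exact: l2norm_ge0.
split => [|[y Ay xy]].
  have hi : has_inf [set l2norm (x - y) | y in A].
    by split => //; exists (l2norm (x - y0)); exists y0.
  by move=> /(inf_lt hi.1)[_ [y Ay <-] xy]; exists y.
by apply: le_lt_trans xy; apply: ge_inf => //; exists y.
Qed.

Lemma gaussZn0 n : @gaussZn R n 0.
Proof. by move=> i; exists 0, 0; rewrite mxE. Qed.

Lemma Gamma2P n (eta : R) (a : 'cV[R[i]]_n) :
  Gamma2 eta a <-> l2norm a = 1 /\ exists (theta : R[i]) (w : 'cV[R[i]]_n),
    [/\ gaussZn w, 0 < cabs theta, cabs theta < n%:R `^ (7 / 10) * eta^-1,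
        l2norm (theta *: a - w) < gamma R n * cabs theta &
        l2norm (theta *: a - w) < alpha R n].
Proof.
have Z0 : @gaussZn R n !=set0 by exists 0; exact: gaussZn0.
rewrite /Gamma2 /Gamma1 /setD /mkset /unit_sphere /mkset; split.
  move=> [a1 /not_andP[//|/negP]]; rewrite -ltNge => /ereal_inf_lt[_ [theta [t0 dt] <-]].
  rewrite lte_fin => tc; split => //.
  move: dt => /(dist_lt _ _ Z0)[w wZ]; rewrite a1 mulr1 lt_min => /andP[h1 h2].
  by exists theta, w.
move=> [a1 [theta [w [wZ t0 tc h1 h2]]]]; split => // -[_]; apply/negP; rewrite -ltNge.
apply: (@le_lt_trans _ _ (cabs theta)%:E); last by rewrite lte_fin.
apply: ereal_inf_lbound; exists theta => //; split => //.
by apply/(dist_lt _ _ Z0); exists w => //; rewrite a1 mulr1 lt_min h1 h2.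
Qed.

Definition gauss_vec n (u : 'cV[(int * int)%type]_n) : 'cV[R[i]]_n :=
  \col_j Complex ((u j 0).1%:~R) ((u j 0).2%:~R).

Lemma gauss_vecP n (w : 'cV[R[i]]_n) : gaussZn w <-> exists u, w = gauss_vec u.
Proof.
split => [wZ|[u ->] i]; last by exists (u i 0).1, (u i 0).2; rewrite mxE.
have /choice[u uP] i : exists p : int * int, w i 0 = Complex (p.1%:~R) (p.2%:~R).
  by have [x [y e]] := wZ i; exists (x, y).
by exists (\col_j u j); apply/matrixP => i j; rewrite ord1 !mxE uP.
Qed.

End Gamma2Description.

Section Events.
Context d (T : measurableType d) (R : realType).
Variables (n : nat) (A : T -> 'M[R[i]]_n).
Hypothesis mA : forall i j, cmeasurable (fun t => A t i j).

(** The Gaussian integer vectors and the sets of rows are countably many. *)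
Lemma measurable_small_lattice_image (Q : 'cV[R[i]]_n -> {set 'I_n} -> Prop)
    (c : 'cV[R[i]]_n -> R) :
  (forall w K, Q w K -> gaussZn w) ->
  measurable [set t | exists w K, Q w K /\ l2norm (coord_proj R K *m A t *m w) <= c w].
Proof.
move=> QZ; rewrite (_ : [set t | _] = \bigcup_(uK : 'cV[(int * int)%type]_n * {set 'I_n})
   [set t | Q (gauss_vec R uK.1) uK.2 /\
     l2norm (coord_proj R uK.2 *m A t *m gauss_vec R uK.1) <= c (gauss_vec R uK.1)]).
  apply: countable_bigcupT_measurable; first exact: countableP.
  move=> [u K] /=; have [q|q] := pselect (Q (gauss_vec R u) K); last first.
    by rewrite (_ : [set t | _] = set0) //; apply/seteqP; split => t //= [].
  rewrite (_ : [set t | _] = [set t |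
     l2norm (coord_proj R K *m A t *m gauss_vec R u) <= c (gauss_vec R u)]).
    apply: measurable_le_cst; apply: measurable_l2norm => i.
    apply: cmeasurable_mulmx => j k; apply: cmeasurable_mulmxl; exact: mA.
  by apply/seteqP; split => t /= => [[]|h].
apply/seteqP; split => t /=.
  move=> [w [K [q h]]]; have /gauss_vecP[u uE] := QZ _ _ q.
  by exists (u, K) => //=; rewrite -uE.
by move=> [[u K] _ /= [q h]]; exists (gauss_vec R u), K.
Qed.

Notation dimR := (n.+1 + n.+1)%N.

(** A pair [(theta, a)] in [C * C^n] is encoded as a real row vector, so
    that bounded closed sets of pairs are compact: the first block of coordinates
    holds the real parts, the second the imaginary parts, and index 0 of each
    block belongs to [theta]. *)
Definition real_to_complex (x : 'rV[R]_dimR) (j : 'I_n.+1) : R[i] :=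
  Complex (x 0 (lshift n.+1 j)) (x 0 (rshift n.+1 j)).
Definition scalar_part x := real_to_complex x ord0.
Definition vector_part x : 'cV[R[i]]_n := \col_j real_to_complex x (lift ord0 j).

Lemma real_to_complex_surj (theta : R[i]) (a : 'cV[R[i]]_n) :
  exists x, scalar_part x = theta /\ vector_part x = a.
Proof.
pose f (j : 'I_n.+1) := if unlift ord0 j is Some k then a k 0 else theta.
exists (\row_(j < dimR) match fintype.split j with inl k => complex.Re (f k) | inr k => complex.Im (f k) end).
have E j : real_to_complex (\row_(j < dimR) match fintype.split j with
    inl k => complex.Re (f k) | inr k => complex.Im (f k) end) j = f j.
  rewrite /real_to_complex !mxE (unsplitK (inl j)) (unsplitK (inr j)).
  by case: (f j).
split; first by rewrite /scalar_part E /f unlift_none.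
by apply/matrixP => i j; rewrite ord1 !mxE E /f liftK.
Qed.

Lemma norm_le_coords x (B : R) : 0 <= B ->
  (forall j, cabs (real_to_complex x j) <= B) -> `|x| <= B.
Proof.
move=> B0 xB; rewrite [leLHS]/Num.Def.normr /= mx_normrE; apply: bigmax_le => // -[i j] _ /=.
rewrite ord1 -(splitK j); case: (fintype.split j) => k /=.
  exact: le_trans (normr_Re_le (real_to_complex x k)) (xB k).
exact: le_trans (normr_Im_le (real_to_complex x k)) (xB k).
Qed.

Lemma ccontinuous_real_to_complex j : ccontinuous (real_to_complex ^~ j).
Proof. by split => x; exact: coord_continuous. Qed.

(** A continuous penalty for the failure of [u <= 0]. *)
Definition excess (u : R) : R := `|u| + u.

Lemma excess_ge0 u : 0 <= excess u.
Proof. by rewrite /excess; have := ler_norm (- u); rewrite normrN; lra. Qed.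

Lemma excess_le0 u : excess u <= 0 <-> u <= 0.
Proof.
rewrite /excess; split => [|u0]; first by have := normr_ge0 u; lra.
by rewrite ler0_norm // addNr.
Qed.

Lemma excess_ge u : u <= excess u.
Proof. by rewrite /excess lerDr. Qed.

Lemma continuous_excess (S : topologicalType) (f : S -> R) :
  continuous f -> continuous (fun x => excess (f x)).
Proof.
move=> cf x; apply: cvgD; last exact: cf.
by apply: cvg_norm; exact: cf.
Qed.

Section Penalty.
Variables (c g al eta : R) (w : 'cV[R[i]]_n) (l : nat).
Let gap : R := l.+1%:R^-1.

(** The zeros of this function are the pairs [(theta, a)] that witness the event
    for the lattice vector [w], with all strict inequalities replaced by
    non-strict ones with a margin [gap].  The sum of excesses is continuous in
    the pair, measurable in the sample point, and its sublevel sets are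
    bounded. *)
Definition penalty (t : T) (x : 'rV[R]_dimR) : R :=
  `|l2norm (vector_part x) - 1| + excess (gap - cabs (scalar_part x))
  + excess (cabs (scalar_part x) - c + gap)
  + excess (l2norm (scalar_part x *: vector_part x - w) - g * cabs (scalar_part x) + gap)
  + excess (l2norm (scalar_part x *: vector_part x - w) - al + gap)
  + excess (l2norm (A t *m vector_part x) - eta).

Lemma measurable_penalty x : measurable_fun setT (penalty ^~ x).
Proof.
apply: measurable_funD; first exact: measurable_cst.
have mf : measurable_fun setT (fun t => l2norm (A t *m vector_part x) - eta).
  apply: measurable_funB; last exact: measurable_cst.
  by apply: measurable_l2norm => i; exact: cmeasurable_mulmx.
apply: measurable_funD => //.
by apply: measurableT_comp => //; exact: measurable_normr.
Qed.

Lemma continuous_penalty t : continuous (penalty t).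
Proof.
have ca i : ccontinuous (fun x => vector_part x i 0).
  rewrite (_ : (fun x => _) = real_to_complex ^~ (lift ord0 i)).
    exact: ccontinuous_real_to_complex.
  by apply/funext => x; rewrite mxE.
have cs : continuous (fun x => cabs (scalar_part x)).
  by apply: continuous_cabs; exact: ccontinuous_real_to_complex.
have cd : continuous (fun x => l2norm (scalar_part x *: vector_part x - w)).
  apply: continuous_l2norm => i.
  rewrite (_ : (fun x => _) = fun x => scalar_part x * vector_part x i 0 + - w i 0).
    apply: ccontinuousD; last exact: ccontinuous_cst.
    by apply: ccontinuousM => //; exact: ccontinuous_real_to_complex.
  by apply/funext => x; rewrite !mxE.
have cA : continuous (fun x => l2norm (A t *m vector_part x)).
  apply: continuous_l2norm => i; rewrite (_ : (fun x => _) =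
    fun x => \sum_j A t i j * vector_part x j 0).
    by apply: ccontinuous_sum => j; apply: ccontinuousM => //; exact: ccontinuous_cst.
  by apply/funext => x; rewrite mxE.
have cn : continuous (fun x => l2norm (vector_part x)) by exact: continuous_l2norm.
have cc (u : R) : continuous (fun _ : 'rV[R]_dimR => u) by exact: cst_continuous.
have cgs := continuous_scale (c := g) cs.
have cn1 := continuous_normr_comp (continuous_subr cn (cc 1)).
have e1 := continuous_excess (continuous_subr (cc gap) cs).
have e2 := continuous_excess (continuous_addr (continuous_subr cs (cc c)) (cc gap)).
have e3 := continuous_excess (continuous_addr (continuous_subr cd cgs) (cc gap)).
have e4 := continuous_excess (continuous_addr (continuous_subr cd (cc al)) (cc gap)).
have e5 := continuous_excess (continuous_subr cA (cc eta)).
exact: (continuous_addr (continuous_addr (continuous_addr (continuous_addr (continuous_addr cn1 e1) e2) e3) e4) e5).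
Qed.

Lemma bounded_penalty t x : 0 <= c -> penalty t x <= 1 -> `|x| <= c + 2.
Proof.
move=> c0; rewrite /penalty.
set u1 := gap - _; set u2 := _ - c + gap; set u3 := _ - g * _ + _; set u4 := _ - al + _.
set u5 := _ - eta; have := excess_ge0 u1; have := excess_ge0 u2; have := excess_ge0 u3.
have := excess_ge0 u4; have := excess_ge0 u5.
have gap0 : 0 <= gap by rewrite invr_ge0.
have h2 : cabs (scalar_part x) - c + gap <= excess u2 by exact: excess_ge.
have := ler_norm (l2norm (vector_part x) - 1).
have := normr_ge0 (l2norm (vector_part x) - 1).
move=> *; apply: norm_le_coords => [|j]; first lra.
have [k ->|->] := unliftP ord0 j; last by rewrite -/(scalar_part x); lra.
by have := l2norm_coord (vector_part x) k; rewrite mxE; lra.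
Qed.

Lemma penalty_le0 t x : penalty t x <= 0 <->
  [/\ l2norm (vector_part x) = 1, gap <= cabs (scalar_part x),
      cabs (scalar_part x) <= c - gap,
      l2norm (scalar_part x *: vector_part x - w) <= Num.min (g * cabs (scalar_part x)) al - gap &
      l2norm (A t *m vector_part x) <= eta].
Proof.
rewrite /penalty.
set u1 := gap - _; set u2 := _ - c + gap; set u3 := _ - g * _ + _; set u4 := _ - al + _.
set u5 := _ - eta; set u0 := _ - 1.
have e1 := excess_ge0 u1; have e2 := excess_ge0 u2; have e3 := excess_ge0 u3.
have e4 := excess_ge0 u4; have e5 := excess_ge0 u5; have e0 := normr_ge0 u0.
split.
  move=> h.
  have /excess_le0 : excess u1 <= 0 by lra.
  have /excess_le0 : excess u2 <= 0 by lra.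
  have /excess_le0 : excess u3 <= 0 by lra.
  have /excess_le0 : excess u4 <= 0 by lra.
  have /excess_le0 : excess u5 <= 0 by lra.
  have /eqP : `|u0| = 0 by lra.
  rewrite normr_eq0 /u0 subr_eq0 => /eqP h0; rewrite /u1 /u2 /u3 /u4 /u5 => h5 h4 h3 h2 h1.
  split => //; try lra.
  by rewrite lerBrDr le_min; apply/andP; split; lra.
move=> [h0 h1 h2]; rewrite lerBrDr le_min => /andP[h3 h4] h5.
have -> : u0 = 0 by rewrite /u0 h0 subrr.
have /excess_le0 : u1 <= 0 by rewrite /u1; lra.
have /excess_le0 : u2 <= 0 by rewrite /u2; lra.
have /excess_le0 : u3 <= 0 by rewrite /u3; lra.
have /excess_le0 : u4 <= 0 by rewrite /u4; lra.
have /excess_le0 : u5 <= 0 by rewrite /u5; lra.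
by rewrite normr0; lra.
Qed.

End Penalty.

Lemma measurable_exists_Gamma2 (eta : R) : 0 < eta ->
  measurable [set t | exists2 a, Gamma2 eta a & l2norm (A t *m a) <= eta].
Proof.
move=> eta0; set c := n%:R `^ (7 / 10) * eta^-1.
have c0 : 0 <= c by rewrite mulr_ge0 ?powR_ge0 // invr_ge0 ltW.
rewrite (_ : [set t | _] = \bigcup_(ul : 'cV[(int * int)%type]_n * nat)
   [set t | exists x, penalty c (gamma R n) (alpha R n) eta (gauss_vec R ul.1) ul.2 t x <= 0]).
  apply: countable_bigcupT_measurable; first exact: countableP.
  move=> [u l]; apply: (@measurable_exists_nonpos _ _ _ _ _ (c + 2)).
  - by move=> x; exact: measurable_penalty.
  - by move=> t; exact: continuous_penalty.
  - by move=> t x; exact: bounded_penalty.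
apply/seteqP; split => t /=.
  move=> [a /Gamma2P[a1 [theta [w [wZ t0 tc h1 h2]]]] Aa].
  have /gauss_vecP[u uE] := wZ.
  (* The strict inequalities hold with some common margin, hence with the
     margin 1 / (l + 1) for [l] large. *)
  pose delta := Num.min (Num.min (cabs theta) (c - cabs theta))
    (Num.min (gamma R n * cabs theta - l2norm (theta *: a - w)) (alpha R n - l2norm (theta *: a - w))).
  have d0 : 0 < delta by rewrite !lt_min t0 !subr_gt0 tc h1 h2.
  have [l] := ltr_add_invr d0; rewrite add0r !lt_min => /andP[/andP[l1 l2] /andP[l3 l4]].
  have [x [xt xa]] := real_to_complex_surj theta a.
  exists (u, l) => //=; exists x; apply/penalty_le0; rewrite xt xa -uE.
  move: l1 l2 l3 l4; move: (l.+1%:R^-1) => e l1 l2 l3 l4; split => //.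
  - exact: ltW.
  - by lra.
  - by rewrite lerBrDr le_min; apply/andP; split; lra.
move=> [[u l] _ /= [x /penalty_le0[h0 h1 h2]]].
have gap0 : 0 < l.+1%:R^-1 :> R by rewrite invr_gt0 ltr0n.
move: (l.+1%:R^-1) gap0 h1 h2 => e e0 h1 h2.
rewrite lerBrDr le_min => /andP[h3 h4] h5.
exists (vector_part x) => //; apply/Gamma2P; split => //.
exists (scalar_part x), (gauss_vec R u); split; rewrite -/c; [by apply/gauss_vecP; exists u|lra..].
Qed.

End Events.

(** * The exceptional event *)

Section BadEvent.
Context d (T : measurableType d) (R : realType) (P : probability T R).

Lemma expR1_le4 : expR 1 <= 4 :> R.
Proof.
have h : 1 / 2 <= expR (- (1 / 2)) :> R by have := expR_ge1Dx (- (1 / 2) : R); lra.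
have -> : expR 1 = (expR (- (1 / 2)) ^+ 2)^-1 :> R.
  by rewrite -expRM_natl -expRN; congr expR; field.
rewrite -[leRHS]invrK lef_pV2 ?posrE ?invr_gt0 ?exprn_gt0 ?expR_gt0 //.
by move: h; set u := expR _; nra.
Qed.

Lemma measure_bigsetU_le (I : Type) (r : seq I) (F : I -> set T) :
  (forall i, measurable (F i)) ->
  (P (\big[setU/set0]_(i <- r) F i) <= \sum_(i <- r) P (F i))%E.
Proof.
move=> mF; elim: r => [|i r IH]; first by rewrite !big_nil measure0.
rewrite !big_cons; apply: (@le_trans _ _ (P (F i) + P (\big[setU/set0]_(i <- r) F i))%E).
  by apply: measureU2 => //; apply: bigsetU_measurable.
exact: leeD2l.
Qed.

Lemma bigsetUP (I : finType) (A : I -> set T) t :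
  (\big[setU/set0]_i A i) t <-> exists i, A i t.
Proof.
rewrite -bigcup_seq; split => [[i _ Ait]|[i Ait]]; exists i => //=.
exact: mem_index_enum.
Qed.

Lemma measurable_count n (A : 'I_n -> set T) (x : R) : (forall i, measurable (A i)) ->
  measurable [set t | x <= #|[set i | t \in A i]%SET|%:R].
Proof.
move=> mA.
have cardE t : #|[set i | t \in A i]%SET|%:R = \sum_i \1_(A i) t :> R.
  rewrite -sum1_card big_mkcond natr_sum; apply: eq_bigr => i _.
  by rewrite inE indicE; case: (t \in A i).
rewrite (_ : [set t | _] = [set t | x <= \sum_i \1_(A i) t]).
  by apply: measurable_ge_cst; apply: measurable_sum => i; exact: measurable_indic.
by apply/seteqP; split => t /=; rewrite cardE.
Qed.

Variables (n : nat) (N : T -> 'M[R[i]]_n).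
Hypothesis mN : forall i j, complex_RV (fun t => N t i j).
Hypothesis indepN : mutually_independent P (fun (ij : 'I_n * 'I_n) t => N t ij.1 ij.2).

Lemma row_count_tail (E : 'I_n -> set T) (p x : R) : 0 <= p ->
  (forall i, <<s row_rectangles N i>> (E i)) -> (forall i, P (E i) <= p%:E)%E ->
  (P [set t | x <= #|[set i | t \in E i]%SET|%:R]%R <= (expR (- x + 3 * p * n%:R))%:E)%E.
Proof.
move=> p0 sE PE.
have mE i : measurable (E i) by exact: (row_sigma_sub mN).
apply: (@le_trans _ _ (expR (- x + (expR 1 - 1) * p * n%:R))%:E).
  apply: count_tail => // S; rewrite (rows_independent mN) //.
  have Ef i : P (E i) = (fine (P (E i)))%:E by rewrite fineK // fin_num_measure.
  under eq_bigr do rewrite Ef.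
  rewrite prodEFin lee_fin -prodr_const; apply: ler_prod => i _.
  by rewrite fine_ge0 //= -lee_fin -Ef.
rewrite lee_fin ler_expR lerD2l ler_wpM2r ?ler0n // ler_wpM2r //.
by have := expR1_le4; lra.
Qed.

Lemma card_letter : #|{: letter n}| = (n * 2 * 2).+1%N.
Proof. by rewrite card_option !card_prod card_ord card_bool. Qed.

Lemma word_vec_pad (W : seq (letter n)) k : word_vec R (W ++ nseq k None) = word_vec R W.
Proof.
rewrite /word_vec big_cat /= big_nseq /= [X in _ + X](_ : _ = 0) ?addr0 //.
by elim: k => //= k ->; rewrite addr0.
Qed.

(** The exceptional event is a union over the rows that are too long and over
    all words of length [D] that spell a vector of controlled norm; each of
    these events is a deviation of a count of independent rows. *)
Lemma bad_event (x p c t v s : R) (D : nat) :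
  0 <= p ->
  (forall i, P [set u | c < \sum_j cabs (N u i j) ^+ 2]%R <= p%:E)%E ->
  (forall i (w : 'cV[R[i]]_n), (sqn w <= v)%R -> P [set u | t < cabs ((N u *m w) i 0)]%R <= p%:E)%E ->
  exists2 Bad : set T,
    measurable Bad /\
    (P Bad <= (((n * 2 * 2).+1%:R ^+ D + 1) * expR (- x + 3 * p * n%:R))%:E)%E &
    forall u, ~ Bad u ->
      #|[set i | c < \sum_j cabs (N u i j) ^+ 2]%SET|%:R < x /\
      forall W : seq (letter n), (size W <= D)%N -> sqn (s%:C%C *: word_vec R W) <= v ->
        #|[set i | t < cabs ((N u *m (s%:C%C *: word_vec R W)) i 0)]%SET|%:R < x.
Proof.
move=> p0 Pnorm Plin.
pose E0 i := [set u | c < \sum_j cabs (N u i j) ^+ 2].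
pose E1 (W : D.-tuple (letter n)) i :=
  [set u | t < cabs ((N u *m (s%:C%C *: word_vec R W)) i 0)].
pose B0 := [set u | x <= #|[set i | u \in E0 i]%SET|%:R].
pose B1 W := if sqn (s%:C%C *: word_vec R (val W)) <= v
  then [set u | x <= #|[set i | u \in E1 W i]%SET|%:R] else set0.
have sE0 i : <<s row_rectangles N i>> (E0 i) by exact: row_sigma_norm.
have sE1 W i : <<s row_rectangles N i>> (E1 W i) by exact: row_sigma_mulmx.
have mB0 : measurable B0 by apply: measurable_count => i; exact: (row_sigma_sub mN).
have mB1 W : measurable (B1 W).
  by rewrite /B1; case: ifP => // _; apply: measurable_count => i; exact: (row_sigma_sub mN).
have mU : measurable (\big[setU/set0]_W B1 W) by apply: bigsetU_measurable.
exists (B0 `|` \big[setU/set0]_W B1 W).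
  split; first exact: measurableU.
  apply: (@le_trans _ _ (P B0 + P (\big[setU/set0]_W B1 W))%E); first exact: measureU2.
  rewrite mulrDl mul1r [X in (_ <= X%:E)%E]addrC EFinD; apply: leeD; first exact: row_count_tail.
  apply: (le_trans (measure_bigsetU_le _ mB1)).
  apply: (@le_trans _ _ (\sum_(W : D.-tuple (letter n)) (expR (- x + 3 * p * n%:R))%:E)%E).
    apply: lee_sum => W _; rewrite /B1; case: ifP => Wv.
      by apply: row_count_tail => // i; exact: Plin.
    by rewrite measure0 lee_fin expR_ge0.
  rewrite sumEFin lee_fin sumr_const -[leLHS]mulr_natl card_tuple card_letter natrX.
  exact: lexx.
move=> u uB; have nB0 : ~ B0 u by move=> h; apply: uB; left.
have nB1 W : ~ B1 W u by move=> h; apply: uB; right; apply/bigsetUP; exists W.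
split.
  rewrite ltNge; apply/negP => h; apply: nB0; rewrite /B0 /=; apply: (le_trans h).
  rewrite ler_nat; apply: subset_leq_card; apply/fintype.subsetP => i.
  by rewrite !finset.in_set => ci; exact: mem_set.
move=> W WD Wv.
have sz : size (W ++ nseq (D - size W) None) == D.
  by rewrite size_cat size_nseq subnKC.
rewrite ltNge; apply/negP => h; apply: (nB1 (Tuple sz)).
rewrite /B1 /= word_vec_pad Wv /=; apply: (le_trans h).
rewrite ler_nat; apply: subset_leq_card; apply/fintype.subsetP => i.
by rewrite !finset.in_set => ci; apply: mem_set; rewrite /E1 /= word_vec_pad.
Qed.

End BadEvent.

(** * Choice of the exponents *)

Section Exponents.
Variables (R : realType) (n : nat).
Hypothesis n0 : (0 < n)%N.
Let pw (a : R) : R := n%:R `^ a.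

Lemma pow_nat_gt0 a : 0 < pw a.
Proof. by rewrite powR_gt0 // ltr0n. Qed.

Lemma pow_natD a b : pw (a + b) = pw a * pw b.
Proof. by rewrite /pw powRD // pnatr_eq0 -lt0n n0 implybT. Qed.

Lemma pow_nat_le a b : a <= b -> pw a <= pw b.
Proof. by apply: ler_powR; rewrite ler1n. Qed.

Lemma pow_nat_ge1 a : 0 <= a -> 1 <= pw a.
Proof. by move=> a0; rewrite -(powRr0 (n%:R : R)); exact: pow_nat_le. Qed.

Lemma pow_nat1 : pw 1 = n%:R.
Proof. by rewrite /pw powRr1 ?ler0n. Qed.

Lemma pow_natX a k : pw a ^+ k = pw (a * k%:R).
Proof. by rewrite -powR_mulrn ?powR_ge0 // -powRrM. Qed.

Lemma pow_nat_sqrt : pw (1 / 2) = Num.sqrt n%:R.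
Proof. by rewrite /pw div1r powR12_sqrt ?ler0n. Qed.

(** The exponent 5/100 makes the logarithm of the number of letters, multiplied
    by the length [n^0.85] of the words, comparable to [n^0.9]. *)
Lemma card_letter_le_expR : (n * 2 * 2).+1%:R <= expR (24 * pw (5 / 100)).
Proof.
set y := pw (5 / 100).
have y1 : 1 <= y by apply: pow_nat_ge1; lra.
have ny : n%:R = y ^+ 20 by rewrite pow_natX -pow_nat1; congr (pw _); lra.
have h1 : y ^+ 20 <= expR (20 * y).
  rewrite (expRM_natl 20) lerXn2r ?nnegrE ?expR_ge0 //; first lra.
  by have := expR_ge1Dx y; lra.
have h2 : 5 <= expR (4 * y).
  by have := expR_ge1Dx (4 * y); lra.
have n1 : 1 <= n%:R :> R by rewrite ler1n.
have -> : 24 * y = 4 * y + 20 * y by ring.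
rewrite expRD -natr1 !natrM; apply: (@le_trans _ _ (5 * y ^+ 20)).
  by rewrite -ny; lra.
by apply: ler_pM => //; rewrite ?exprn_ge0 //; lra.
Qed.

(** All the losses are of the form [exp (O (n^0.9))], whereas the gain is
    [exp (- n^0.99)]; the threshold 300 for [n^0.09] exceeds the sum of the
    constants divided by 9/10. *)
Lemma bad_event_bound : 300 <= pw (9 / 100) ->
  ((n * 2 * 2).+1%:R ^+ Num.truncn (6 * pw (85 / 100)) + 1)
    * expR (- pw (99 / 100) + 3 * (14 * pw (- (10 / 100))) * n%:R)
  <= expR (- pw (99 / 100) / 10).
Proof.
move=> big; set y := pw (90 / 100).
have y1 : 1 <= y by apply: pow_nat_ge1; lra.
have xE : pw (99 / 100) = y * pw (9 / 100) by rewrite -pow_natD; congr (pw _); lra.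
have -> : 3 * (14 * pw (- (10 / 100))) * n%:R = 42 * y.
  have -> : y = pw (- (10 / 100)) * n%:R.
    by rewrite -[X in _ * X]pow_nat1 -pow_natD; congr (pw _); lra.
  by ring.
set D := Num.truncn _.
have DB : D%:R <= 6 * pw (85 / 100).
  by rewrite truncn_le // mulr_ge0 // ltW // pow_nat_gt0.
have h1 : (n * 2 * 2).+1%:R ^+ D <= expR (144 * y).
  apply: (@le_trans _ _ (expR (24 * pw (5 / 100)) ^+ D)).
    by apply: lerXn2r; rewrite ?nnegrE ?ler0n ?expR_ge0 //; exact: card_letter_le_expR.
  rewrite -expRM_natl ler_expR.
  have -> : 144 * y = (6 * pw (85 / 100)) * (24 * pw (5 / 100)).
    rewrite mulrACA -pow_natD; congr (_ * _); first by lra.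
    by congr (pw _); lra.
  by rewrite ler_wpM2r // mulr_ge0 // ltW // pow_nat_gt0.
have h2 : (n * 2 * 2).+1%:R ^+ D + 1 <= expR (145 * y).
  have -> : 145 * y = y + 144 * y by ring.
  rewrite expRD; have e1 := expR_ge1Dx y; have e2 := expR_ge1Dx (144 * y).
  move: h1 e1 e2; move: (expR y) (expR (144 * y)) (_ ^+ D) => E1 E2 A *; nra.
apply: (@le_trans _ _ (expR (145 * y) * expR (- pw (99 / 100) + 42 * y))).
  by rewrite ler_wpM2r ?expR_ge0.
rewrite -expRD ler_expR xE.
move: y1 big; clear; move: (pw (9 / 100)) => m; move: y => y y1 big.
have : y * 300 <= y * m by apply: ler_wpM2l => //; lra.
lra.
Qed.

End Exponents.

Section GoodRows.
Variables (R : realType) (n : nat) (N : 'M[R[i]]_n).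
Hypothesis n0 : (0 < n)%N.
Let pw (a : R) : R := n%:R `^ a.

(** The exponents satisfy [2 * 0.35 + 1.4 = 2.1]: with mesh [n^-0.35] and total
    squared norm [n^2.1] of the selected rows, the rounding error contributes
    [n^1.4] to [|P_K N b|^2], as much as [n] entries of size [n^0.2]. *)
Lemma good_rows_exist (b : 'cV[R[i]]_n) :
  #|[set i | pw (110 / 100) < \sum_j cabs (N i j) ^+ 2]%SET|%:R < pw (99 / 100) ->
  (forall W : seq (letter n), (size W <= Num.truncn (6 * pw (85 / 100)))%N ->
     sqn ((pw (- (35 / 100)))%:C%C *: word_vec R W) <= 14 * pw (30 / 100) ->
     #|[set i | pw (20 / 100) <
        cabs ((N *m ((pw (- (35 / 100)))%:C%C *: word_vec R W)) i 0)]%SET|%:R < pw (99 / 100)) ->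
  exists2 K, calK R K & l2norm (coord_proj R K *m N *m b) <= 4 * pw (70 / 100) * l2norm b.
Proof.
move=> normN linN.
set s := pw (- (35 / 100)) in linN *; set t := pw (20 / 100) in linN *.
set Bad0 := [set i | _]%SET in normN *; set G := ~: Bad0.
have p0 a : 0 < pw a by exact: pow_nat_gt0.
have pD a a' : pw (a + a') = pw a * pw a' by exact: pow_natD.
pose H := n%:R * pw (110 / 100).
have H0 : 0 < H by rewrite mulr_gt0 // ltr0n.
have GH : \sum_(i in G) \sum_j cabs (N i j) ^+ 2 <= H.
  apply: (@le_trans _ _ (\sum_(i in G) pw (110 / 100))).
    by apply: ler_sum => i; rewrite !finset.in_set -leNgt.
  rewrite sumr_const -[leLHS]mulr_natl; apply: ler_wpM2r; first exact: ltW.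
  rewrite ler_nat.
  by rewrite -[leqRHS]card_ord max_card.
(* When [b = 0] the vector [bh] is 0 too, so normalisation needs no separate
   case later on. *)
pose bet := l2norm b; pose bh := (bet^-1)%:C%C *: b.
have bet0 : 0 <= bet by exact: l2norm_ge0.
have bhE : b = bet%:C%C *: bh.
  have [z|nz] := eqVneq bet 0.
    by rewrite /bh (l2norm_eq0 z) !scaler0.
  by rewrite /bh scalerA -rmorphM mulfV //= scale1r.
have bh1 : l2norm bh <= 1.
  rewrite /bh l2normZ cabs_real ger0_norm ?invr_ge0 // -/bet.
  have [->|nz] := eqVneq bet 0; first by rewrite mulr0.
  by rewrite mulVf.
have [W [sW vW KW]] := word_controls_rows n0 H0 (p0 _ : 0 < s) (ltW (p0 _) : 0 <= t) GH bh1.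
have s2n : s ^+ 2 * n%:R = pw (30 / 100).
  by rewrite -(pow_nat1 R n) /s pow_natX -pD; congr (pw _); lra.
have ge1 : 1 <= pw (30 / 100) by apply: pow_nat_ge1 => //; lra.
have {}vW : sqn (s%:C%C *: word_vec R W) <= 14 * pw (30 / 100).
  by apply: (le_trans vW); rewrite -mulrA s2n; lra.
have {}sW : (size W <= Num.truncn (6 * pw (85 / 100)))%N.
  rewrite truncn_ge_nat; last by rewrite mulr_ge0 // ltW.
  apply: (le_trans sW); rewrite -pow_nat_sqrt // -mulrA -/(pw _) /s -powRN -/(pw _) -pD.
  by rewrite ler_pM2l //; apply: pow_nat_le => //; lra.
have linW := linN W sW vW; set Bad1 := [set i | _]%SET in linW.
pose K := G :\: Bad1; exists K.
  rewrite /calK /=.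
  have cK : (#|~: K| <= #|Bad0| + #|Bad1|)%N.
    by rewrite /K /G finset.setDE finset.setCI !finset.setCK; apply: leq_card_setU.
  have : (#|K|%:R + #|~: K|%:R = n%:R :> R) by rewrite -natrD cardsC card_ord.
  have : #|~: K|%:R <= #|Bad0|%:R + #|Bad1|%:R :> R by rewrite -natrD ler_nat.
  have := p0 (99 / 100); rewrite -/(pw _); lra.
have KG : K \subset G by exact: subsetDl.
have {}KW := KW K KG _.
have h : sqn (coord_proj R K *m N *m bh) <= (4 * pw (70 / 100)) ^+ 2.
  apply: (le_trans (KW _)).
    by move=> i; rewrite !finset.in_set -leNgt => /andP[].
  have -> : 2 * n%:R * t ^+ 2 = 2 * pw (140 / 100).
    by rewrite -mulrA -(pow_nat1 R n) /t pow_natX -pD; congr (_ * pw _); lra.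
  have -> : 12 * s ^+ 2 * H = 12 * pw (140 / 100).
    rewrite /H -mulrA [s ^+ 2 * _]mulrA s2n -pD; congr (_ * pw _); lra.
  have -> : (4 * pw (70 / 100)) ^+ 2 = 16 * pw (140 / 100).
    by rewrite exprMn pow_natX; congr (_ * pw _); lra.
  by have := p0 (140 / 100); lra.
rewrite [in leLHS]bhE -scalemxAr l2normZ cabs_real ger0_norm // mulrC ler_wpM2r //.
have c0 : 0 <= 4 * pw (70 / 100) by rewrite mulr_ge0 // ltW.
by rewrite -(@ler_pXn2r _ 2) ?nnegrE ?l2norm_ge0 // sqr_l2norm.
Qed.

End GoodRows.

(** * From Gamma2 to lattice vectors *)

(** The lattice vector close to [theta a] inherits the smallness of
    [M_n a] up to the image of the error [b].  The two terms of the minimum come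
    from the two bounds on [|b|]: the one proportional to [|theta|] is compared
    with [|w|], the absolute one with [n^0.711]. *)
Lemma lattice_vector_of_Gamma2 (R : realType) (n : nat) (eta : R) (M N : 'M[R[i]]_n)
    (a : 'cV[R[i]]_n) :
  (0 < n)%N -> 0 < eta -> eta < n%:R ^- 2 ->
  300 <= n%:R `^ (9 / 100) :> R ->
  (opnorm M <= (n%:R `^ (51 / 100))%:E)%E ->
  (forall b : 'cV[R[i]]_n, exists2 K, calK R K &
     l2norm (coord_proj R K *m N *m b) <= 4 * n%:R `^ (70 / 100) * l2norm b) ->
  Gamma2 eta a -> l2norm ((M + N) *m a) <= eta ->
  exists w K, [/\ bfV eta w, calK R K &
    l2norm (coord_proj R K *m (M + N) *m w)
      <= 12 * Num.min (n%:R `^ (21 / 100) * l2norm w) (n%:R `^ (711 / 1000))].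
Proof.
move=> n0 eta0 eta_lt; pose pw (x : R) : R := n%:R `^ x.
rewrite -!/(pw _) => big opM goodN.
move=> /Gamma2P[a1 [theta [w [wZ t0 tc h1 h2]]]] Aa.
have p0 x : 0 < pw x by exact: pow_nat_gt0.
have pD x y : pw (x + y) = pw x * pw y by exact: pow_natD.
have ple x y : x <= y -> pw x <= pw y by exact: pow_nat_le.
have [K Kn hK] := goodN (w - theta *: a).
pose b := w - theta *: a.
have [bet betE] : exists bet, bet = l2norm b by exists (l2norm b).
have [tau tauE] : exists tau, tau = cabs theta by exists (cabs theta).
have distE : l2norm (theta *: a - w) = bet by rewrite betE /b -l2normN opprB.
rewrite distE -tauE in h1; rewrite distE in h2; rewrite -tauE in t0 tc.
have {}h1 : bet < pw (- (1 / 2)) * tau by [].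
have {}h2 : bet < pw (1 / 100) by [].
have bet0 : 0 <= bet by rewrite betE l2norm_ge0.
have half : pw (- (1 / 2)) <= 1 / 2.
  have e : pw (- (1 / 2)) * pw (1 / 2) = 1 by rewrite -pD addNr /pw powRr0.
  have h : 300 <= pw (1 / 2) by apply: (le_trans big); apply: ple; clear; lra.
  move: e h (p0 (- (1 / 2))); move: (pw (- (1 / 2))) (pw (1 / 2)) => u v; clear; nra.
have wE : w = theta *: a + b by rewrite /b addrC subrK.
have ta : l2norm (theta *: a) = tau by rewrite l2normZ a1 mulr1.
have w_ub : l2norm w <= tau + bet.
  by rewrite wE betE; apply: (le_trans (l2norm_triangle _ _)); rewrite ta.
have w_lb : tau <= 2 * l2norm w.
  have := l2norm_triangle w (- b); rewrite l2normN {1}wE addrK ta -betE.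
  have : bet <= 1 / 2 * tau by apply: (le_trans (ltW h1)); rewrite ler_wpM2r // ltW.
  by move: (l2norm w) => lw; clear; lra.
have etai1 : 1 <= eta^-1.
  rewrite invf_ge1 //; apply: (le_trans (ltW eta_lt)); rewrite invf_le1 ?exprn_gt0 ?ltr0n //.
  by rewrite exprn_ege1 // ler1n.
have sup_w : l2norm w <= 2 * eta^-1 * pw (3 / 4).
  apply: (le_trans w_ub).
  have t1 : tau <= pw (3 / 4) * eta^-1.
    by apply: (le_trans (ltW tc)); rewrite ler_pM2r ?invr_gt0 //; apply: ple; clear; lra.
  have t2 : bet <= pw (3 / 4) * eta^-1.
    apply: (le_trans (ltW h2)); apply: (@le_trans _ _ (pw (3 / 4))); first by apply: ple; clear; lra.
    by rewrite ler_peMr // ltW.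
  by rewrite -mulrA [eta^-1 * _]mulrC mulr_natl mulr2n; apply: lerD.
have etaE : eta^-1 * eta = 1 by rewrite mulVf // gt_eqF.
exists w, K; split => //.
  have c0 : 0 <= 2 * eta^-1 * pw (3 / 4) by exact: le_trans (l2norm_ge0 w) sup_w.
  split => //.
  - apply/negP => /eqP w0; move: w_lb; rewrite w0 l2norm0 mulr0 => /(lt_le_trans t0).
    by rewrite ltxx.
  - rewrite [leLHS]/Num.Def.normr /= mx_normrE; apply: bigmax_le => // -[i j] _ /=.
    rewrite mxE ord1; apply: (le_trans (normr_Re_le _)).
    exact: le_trans (l2norm_coord w i) sup_w.
  - rewrite [leLHS]/Num.Def.normr /= mx_normrE; apply: bigmax_le => // -[i j] _ /=.
    rewrite mxE ord1; apply: (le_trans (normr_Im_le _)).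
    exact: le_trans (l2norm_coord w i) sup_w.
have main : l2norm (coord_proj R K *m (M + N) *m w) <= tau * eta + 5 * pw (70 / 100) * bet.
  have -> : coord_proj R K *m (M + N) *m w = coord_proj R K *m (theta *: ((M + N) *m a))
      + (coord_proj R K *m (M *m b) + coord_proj R K *m N *m b).
    by rewrite {1}wE -!mulmxA mulmxDr -scalemxAr mulmxDr [(M + N) *m b]mulmxDl mulmxDr.
  apply: (le_trans (l2norm_triangle _ _)); apply: lerD.
    apply: (le_trans (l2norm_coord_proj_le _ _)); rewrite l2normZ.
    by rewrite -tauE ler_wpM2l // ltW.
  apply: (le_trans (l2norm_triangle _ _)).
  have e1 := le_trans (l2norm_coord_proj_le K (M *m b)) (l2norm_mulmx_le b opM).
  have e2 : pw (51 / 100) * bet <= pw (70 / 100) * bet by apply: ler_wpM2r => //; apply: ple; clear; lra.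
  move: hK e1 e2; rewrite -/b -betE; move: (l2norm _) (l2norm _) => u v.
  rewrite -!mulrA; move: (pw _ * _) (pw _ * _) => x y; clear; lra.
apply: (le_trans main); rewrite -ler_pdivrMl // le_min; apply/andP; split; rewrite ler_pdivrMl //.
  have e1 : tau * eta <= tau * pw (21 / 100).
    rewrite ler_pM2l //; apply: (@le_trans _ _ 1); last by apply: pow_nat_ge1 => //; lra.
    by rewrite -invf_ge1.
  have e2 : pw (70 / 100) * bet <= pw (21 / 100) * tau.
    apply: (@le_trans _ _ (pw (70 / 100) * (pw (- (1 / 2)) * tau))).
      by rewrite ler_pM2l // ltW.
    by rewrite mulrA -pD ler_pM2r //; apply: ple; clear; lra.
  have e3 : pw (21 / 100) * tau <= pw (21 / 100) * (2 * l2norm w) by rewrite ler_pM2l.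
  move: e1 e2 e3; rewrite -mulrA.
  rewrite [tau * pw _]mulrC; move: w_lb; have := p0 (21 / 100).
  move: (pw (21 / 100)) (pw (70 / 100) * bet) (l2norm w) => u v lw; clear; nra.
have e1 : tau * eta <= pw (711 / 1000).
  apply: (@le_trans _ _ (pw (7 / 10))); last by apply: ple; clear; lra.
  by move: tc; rewrite ltr_pdivlMr // => /ltW.
have e2 : pw (70 / 100) * bet <= pw (711 / 1000).
  apply: (@le_trans _ _ (pw (70 / 100) * pw (1 / 100))); first by rewrite ler_pM2l // ltW.
  by rewrite -pD; apply: ple; clear; lra.
rewrite -mulrA; move: e1 e2 (p0 (711 / 1000)); move: (pw (711 / 1000)) (pw (70 / 100) * bet) => u v; clear; lra.
Qed.

Lemma pow_nat99_le (R : realType) (n : nat) (B : R) :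
  n%:R `^ (9 / 100) <= B -> n%:R `^ (99 / 100) <= B ^+ 11.
Proof.
move=> nB; rewrite (_ : 99 / 100 = 9 / 100 * 11%:R :> R); last by clear; lra.
rewrite -pow_natX; have a0 : 0 <= n%:R `^ (9 / 100) :> R by exact: powR_ge0.
by apply: lerXn2r => //; rewrite nnegrE; exact: le_trans a0 nB.
Qed.

Theorem proposition3p3 (R : realType) :
  exists C0 : R, 1 <= C0 /\
  forall (d0 : measure_display) (T0 : measurableType d0)
    (P0 : probability T0 R) (z : T0 -> R[i])
    (n : nat) (eta : R) (M : 'M[R[i]]_n)
    (d : measure_display) (T : measurableType d)
    (P : probability T R) (N : T -> 'M[R[i]]_n),
  complex_RV z -> complex_integrable P0 z ->
  complex_mean P0 z = 0 -> complex_variance P0 z = 1%E ->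
  (0 < n)%N ->
  2 `^ (- (n%:R `^ (1 / 10000))) <= eta -> eta < n%:R ^- 2 ->
  (opnorm M <= (n%:R `^ (51 / 100))%:E)%E ->
  iid_matrix P P0 N z ->
  (P [set t | exists2 a, Gamma2 eta a & l2norm ((M + N t) *m a) <= eta]%R
   <= (C0 * expR (- (n%:R `^ (99 / 100)) / 10))%R%:E
    + P [set t | exists w K, [/\ bfV eta w, calK R K &
           l2norm (coord_proj R K *m (M + N t) *m w)
           <= C0 * Num.min (n%:R `^ (21 / 100) * l2norm w)
                           (n%:R `^ (711 / 1000))]]%R)%E.
Proof.
set L : R := 300 ^+ 11 / 10.
have L30 : 30 <= L.
  rewrite /L ler_pdivlMr //; apply: (@le_trans _ _ (300 ^+ 1)); first by rewrite expr1; lra.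
  by rewrite ler_weXn2l // ler1n.
have C12 : 12 <= expR L by have := expR_ge1Dx L; lra.
exists (expR L); split; first lra.
move=> d0 T0 P0 z n eta M d T P N mz iz z0 z1 n0 eta_ge eta_lt opM iid.
have eta0 : 0 < eta by apply: lt_le_trans eta_ge; rewrite powR_gt0.
have mN := iid_complex_RV iid.
have mA i j : cmeasurable (fun t => (M + N t) i j).
  rewrite (_ : (fun t => _) = fun t => M i j + N t i j); last by apply/funext => t; rewrite mxE.
  by apply: cmeasurableD; [exact: cmeasurable_cst|exact: iid_cmeasurable iid i j].
set E1 := [set t | _]; set E2 := [set t | _].
have mE1 : measurable E1 by exact: measurable_exists_Gamma2.
have mE2 : measurable E2.
  rewrite (_ : E2 = [set t | exists w K, (bfV eta w /\ calK R K) /\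
    l2norm (coord_proj R K *m (M + N t) *m w) <= expR L *
      Num.min (n%:R `^ (21 / 100) * l2norm w) (n%:R `^ (711 / 1000))]).
    by apply: (measurable_small_lattice_image mA (Q := fun w K => bfV eta w /\ calK R K))
      => w K [[]].
  apply/seteqP; split => t /=.
    by move=> [w [K [h1 h2 h3]]]; exists w, K.
  by move=> [w [K [[h1 h2] h3]]]; exists w, K.
(* For small [n] the constant alone makes the right-hand side at least 1. *)
have [big|small] := leP (300 : R) (n%:R `^ (9 / 100)); last first.
  apply: (@le_trans _ _ 1%E); first exact: probability_le1.
  apply: (@le_trans _ _ (expR L * expR (- (n%:R `^ (99 / 100)) / 10))%:E); last by rewrite leeDl.
  rewrite lee_fin -expRD; apply: (@le_trans _ _ (expR 0)); first by rewrite expR0.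
  rewrite ler_expR /L.
  have := pow_nat99_le (n := n) (ltW small).
  by move: (_ `^ _) (_ ^+ 11) => a b; clear; lra.
have [_ _ indep] := iid.
pose pw (x : R) : R := n%:R `^ x.
have pw0 x : 0 < pw x by exact: pow_nat_gt0.
have pwD x y : pw (x + y) = pw x * pw y by exact: pow_natD.
have p0 : 0 <= 14 * pw (- (10 / 100)) by rewrite mulr_ge0 // ltW.
have Pnorm i : (P [set u | pw (110 / 100) < \sum_j cabs (N u i j) ^+ 2]%R
    <= (14 * pw (- (10 / 100)))%:E)%E.
  apply: le_trans (row_norm_tail mz z0 z1 iid i (pw0 _)) _; rewrite lee_fin.
  rewrite -[n%:R]pow_nat1 -powRN -/(pw _) -/(pw _) -pwD.
  rewrite (_ : 1 + - (110 / 100) = - (10 / 100)); last by clear; lra.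
  by move: (pw0 (- (10 / 100))); move: (pw _) => u; clear; lra.
have Plin i (w : 'cV[R[i]]_n) : sqn w <= 14 * pw (30 / 100) ->
    (P [set u | pw (20 / 100) < cabs ((N u *m w) i 0)]%R <= (14 * pw (- (10 / 100)))%:E)%E.
  move=> sw; apply: le_trans (mulmx_tail mz iz z0 z1 iid i w (pw0 _)) _; rewrite lee_fin.
  rewrite pow_natX ler_pdivrMr // -mulrA -pwD; apply: (le_trans sw).
  rewrite (_ : - (10 / 100) + 20 / 100 * 2%:R = 30 / 100) //; clear; lra.
have [Bad [mBad PBad] goodBad] := bad_event mN indep (pw (99 / 100))
  (pw (- (35 / 100))) (Num.truncn (6 * pw (85 / 100))) p0 Pnorm Plin.
apply: (@le_trans _ _ (P (Bad `|` E2))).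
  apply: le_measure; rewrite ?inE //; first exact: measurableU.
  move=> t [a Ga aeta]; have [tB|tB] := pselect (Bad t); [by left|right].
  have [normN linN] := goodBad t tB.
  have [w [K [wV Kn wK]]] := lattice_vector_of_Gamma2 n0 eta0 eta_lt big opM
    (fun b => good_rows_exist n0 b normN linN) Ga aeta.
  exists w, K; split => //; apply: (le_trans wK); apply: ler_wpM2r => //.
  by rewrite le_min mulr_ge0 ?powR_ge0 ?l2norm_ge0.
apply: (le_trans (measureU2 _ _ _)) => //; apply: leeD2r.
apply: (le_trans PBad); rewrite lee_fin.
apply: (le_trans (bad_event_bound n0 big)).
apply: ler_peMl; first exact: expR_ge0.
by apply: le_trans C12; rewrite ler1n.
Qed.
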